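(* Let $\alpha\in(0,1)$ be fixed. For every positive integer $n$ (even or odd), all independent random vectors $X_1,\ldots,X_n$ in $\mathbb{R}^d$ such that $\sup_{y\in\mathbb{R}^d}\mathbb{P}(X_i=y)\le\alpha$ for all $i\in\{1,\dots,n\}$, and every $x\in\mathbb{R}^d$, $$\mathbb{P}(X_1+\cdots+X_n=x)\le\left(2\pi n\operatorname{Var}(U^\alpha)\right)^{-\frac12}(1+o(1)),$$ where the $o(1)$ term is a sequence depending only on $n$ and $\alpha$ that tends to $0$ as $n\to\infty$, and where $$\operatorname{Var}(U^\alpha)=\frac1{12}\lfloor\alpha^{-1}\rfloor\left(\lfloor\alpha^{-1}\rfloor+1\right)\alpha\left(2+4\lfloor\alpha^{-1}\rfloor-3\alpha\lfloor\alpha^{-1}\rfloor-3\alpha\lfloor\alpha^{-1}\rfloor^2\right).$$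
   Context: For $\alpha\in(0,1)$, $U^\alpha$ denotes an integer-valued random variable with $\mathbb{P}(U^\alpha=l)=\alpha$ for $l=0,1,\ldots,\lfloor 1/\alpha\rfloor-1$ and $\mathbb{P}(U^\alpha=\lfloor 1/\alpha\rfloor)=1-\alpha\lfloor 1/\alpha\rfloor$. *)

(* Defs.v *)
From HB Require Import structures.
From mathcomp Require Import all_boot all_order all_algebra.
From mathcomp Require Import all_classical all_reals all_analysis.

Set Implicit Arguments.
Unset Strict Implicit.
Unset Printing Implicit Defensive.

Import Order.TTheory GRing.Theory Num.Theory.
Import numFieldNormedType.Exports.

Local Open Scope classical_set_scope.
Local Open Scope ring_scope.

(* R^d, as row vectors, carries its Borel sigma-algebra: the one generated by
   the open sets of the product topology. *)
Section borel_rV.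
Context (R : realType) (d : nat).

HB.instance Definition _ :=
  @isMeasurable.Build (sigma_display (@open 'rV[R]_d)) 'rV[R]_d
    <<s @open 'rV[R]_d >>
    (@sigma_algebra0 _ setT (@open 'rV[R]_d))
    (@sigma_algebraC _ (@open 'rV[R]_d))
    (@sigma_algebra_bigcup _ setT (@open 'rV[R]_d)).

End borel_rV.

(* Subfamilies are covered by taking A i := setT for the other indices. *)
Definition mutually_independent (dT dV : measure_display)
    (T : measurableType dT) (V : measurableType dV) (R : realType)
    (P : probability T R) (n : nat) (X : 'I_n -> {RV P >-> V}) : Prop :=
  forall A : 'I_n -> set V, (forall i, measurable (A i)) ->
    P (\bigcap_(i in [set: 'I_n]) (X i @^-1` A i))
    = (\prod_(i < n) P (X i @^-1` A i))%E.

Section law_of_U.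
Context (R : realType) (a : R).

(* Num.truncn a^-1 is the floor of a^-1, since a^-1 >= 0 in all uses. *)
Definition U_pmf (l : nat) : R :=
  if (l < Num.truncn a^-1)%N then a
  else if l == Num.truncn a^-1 then 1 - a * (Num.truncn a^-1)%:R
  else 0.

Lemma U_pmf_ge0 l : 0 < a < 1 -> 0 <= U_pmf l.
Proof.
move=> /andP[a0 _]; rewrite /U_pmf; case: ifP => _; first exact: ltW.
case: ifP => // _; rewrite subr_ge0 mulrC -ler_pdivlMr// mul1r.
by rewrite truncn_le// invr_ge0 ltW.
Qed.

Lemma sum_U_pmf : \sum_(l < (Num.truncn a^-1).+1) U_pmf l = 1.
Proof.
rewrite big_ord_recr/= {2}/U_pmf ltnn eqxx.
under eq_bigr => i _ do rewrite /U_pmf ltn_ord.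
by rewrite sumr_const card_ord -[a *+ _]mulr_natr addrC subrK.
Qed.

(* As U_pmf is a probability mass function only for suitable a, the Dirac mass
   at 0 is used outside of 0 < a < 1 to obtain a probability for every a. *)
Definition U_law (A : set nat) : \bar R :=
  if 0 < a < 1 then \esum_(l in A) (U_pmf l)%:E else \d_0%N A.

Local Open Scope ereal_scope.

Let U_law0 : U_law set0 = 0.
Proof. by rewrite /U_law measure0; case: ifPn => //; rewrite esum_set0. Qed.

Let U_law_ge0 A : 0 <= U_law A.
Proof.
rewrite /U_law; case: ifPn => // a01; apply: esum_ge0 => /= k _.
by rewrite lee_fin U_pmf_ge0.
Qed.

Let U_law_sigma_additive : semi_sigma_additive U_law.
Proof.
move=> F mF tF mUF; rewrite /U_law; case: ifPn => a01; last first.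
  exact: measure_semi_sigma_additive.
apply: cvg_toP.
  apply: ereal_nondecreasing_is_cvgn => k l kl.
  apply: lee_sum_nneg_natr => // i _ _.
  by apply: esum_ge0 => /= ? _; rewrite lee_fin U_pmf_ge0.
by rewrite nneseries_sum_bigcup// => i; rewrite lee_fin U_pmf_ge0.
Qed.

HB.instance Definition _ := isMeasure.Build _ _ _ U_law
  U_law0 U_law_ge0 U_law_sigma_additive.

Let U_law_setT : U_law [set: _] = 1.
Proof.
rewrite /U_law; case: ifPn => [a01|_]; last by rewrite probability_setT.
have p0 l : 0 <= (U_pmf l)%:E by rewrite lee_fin U_pmf_ge0.
rewrite (esumID `I_(Num.truncn a^-1).+1)// [X in _ + X]esum1 ?adde0; last first.
  move=> /= k [_ /negP]; rewrite -leqNgt /U_pmf => ak.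
  by rewrite ltnNge ltnW//= gtn_eqF.
by rewrite setTI esum_fset// -fsbig_ord//= sumEFin sum_U_pmf.
Qed.

HB.instance Definition _ :=
  @Measure_isProbability.Build _ _ R U_law U_law_setT.

(* U^a is realised on the probability space (nat, U_law) by the inclusion of
   nat into R. *)
Definition U_rv (l : nat) : R := l%:R.

Definition varU : \bar R := 'V_(U_law)[U_rv].

End law_of_U.

(* Main.v *)
From HB Require Import structures.
Require Import Defs.
From mathcomp Require Import all_boot all_order all_algebra.
From mathcomp Require Import zify ring lra.
From mathcomp Require Import all_classical all_reals all_analysis measurable_realfun.

Set Implicit Arguments.
Unset Strict Implicit.
Unset Printing Implicit Defensive.

Import Order.TTheory GRing.Theory Num.Theory.
Import numFieldNormedType.Exports.

Local Open Scope classical_set_scope.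
Local Open Scope ring_scope.

(* Put S = X_1 + .. + X_n. Up to an arbitrarily small error the X_i may be
   confined to a finite set F of atoms, because the event that X_i misses F and
   S = x has, conditionally on the other variables, at most the mass of one
   small atom; a generic linear functional then carries F injectively to the
   line. Splitting the sum into two halves A and B, the arithmetic-geometric
   inequality bounds P(S = x) by the mean of the collision probabilities
   P(S_A = S_A') and P(S_B = S_B'), where S_A' is an independent copy of S_A.
   A rearrangement inequality of Riesz type shows that these are largest when
   every X_i is distributed as U, centred as symmetrically as possible: the sum
   of a convolution over a set of odd size is at most the corresponding sum over
   a centred integer interval, since a k-set and an l-set have at least k + l - 1
   distinct sums. Finally the collision probability of U is the integral of a
   power of |E exp(itU)|^2, which Laplace's method compares with a Gaussian
   integral. *)

(** * Rearrangement *)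

(** Two obstacles shape the rearrangement. A centred integer interval has an odd number of points,
    so the Riesz type inequality controls only sets of odd size, whereas iterating it requires
    control over all sizes. Working with differences closes this gap: the law of S_A - S_A' is even
    and largest at 0, and these two properties carry the odd case over to every size. The other
    obstacle is that the lower bound on the number of distinct sums is proved from a linear order,
    hence the passage from R^d to the line. The constant arises as follows. With k = n/2 variables
    in each half, S_A - S_A' has, in the extremal case, variance 2k Var(U), which is n Var(U), and
    the Gaussian density of that variance at 0 is (2 pi n Var(U))^(-1/2). For odd n one variable is
    given up, a loss that the o(1) absorbs. *)

Section rearrangement_sequences.
Context (R : realFieldType).

Lemma ler_sum_abel (n : nat) (x y z : nat -> R) :
  (forall k, (k <= n)%N -> \sum_(i < k) x i <= \sum_(i < k) y i) ->
  (forall i, 0 <= z i) -> (forall i, (i.+1 < n)%N -> z i.+1 <= z i) ->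
  \sum_(i < n) x i * z i <= \sum_(i < n) y i * z i.
Proof.
move=> xy z0 zd.
case: n xy zd => [|n] xy zd; first by rewrite !big_ord0.
rewrite -subr_ge0 -sumrB.
(* Abel summation as an induction: going from k to k + 1 lowers the weight in front of a partial sum
   that is nonnegative. *)
suff H k : (k <= n)%N -> z k * \sum_(i < k.+1) (y i - x i) <=
    \sum_(i < k.+1) (y i * z i - x i * z i).
  apply: le_trans (H n _) => //; apply: mulr_ge0 => //.
  by rewrite sumrB subr_ge0; apply: xy.
elim: k => [|k IH] kn; first by rewrite !big_ord_recl !big_ord0 !addr0; lra.
rewrite big_ord_recr [leRHS]big_ord_recr /= mulrDr.
have H1 : z k.+1 * \sum_(i < k.+1) (y i - x i) <=
    z k * \sum_(i < k.+1) (y i - x i).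
  apply: ler_wpM2r; last by apply: zd.
  by rewrite sumrB subr_ge0; apply: xy; lia.
have := IH (ltnW kn); move: H1; set s1 := \sum_(i < _) _; set s2 := \sum_(i < _) _.
by move=> *; lra.
Qed.

(** Weak majorization, stated over all finite sets so that no decreasing rearrangement of [h] has to
    be formed. *)
Definition dominated (G : eqType) (h : G -> R) (g : nat -> R) :=
  forall K : seq G, uniq K -> \sum_(x <- K) h x <= \sum_(i < size K) g i.

(** Once [S] is sorted by decreasing [h], Abel summation applies twice: the values of [h] are the
    decreasing weights when [c] is replaced by [g], then [g] gives the weights when [h] is replaced
    by [eta]. *)
Lemma ler_sum_pairing (G : eqType) (c h : G -> R) (g eta : nat -> R)
    (S : seq G) :
  uniq S -> (forall x, 0 <= h x) -> (forall i, 0 <= g i) ->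
  (forall i, g i.+1 <= g i) -> dominated c g -> dominated h eta ->
  \sum_(x <- S) c x * h x <= \sum_(i < size S) g i * eta i.
Proof.
move=> uS h0 g0 gd cg he; pose r x y := h y <= h x.
have tot : total r by move=> x y; apply: le_total.
have rtr : transitive r by move=> y x z xy yz; apply: le_trans xy.
pose T := sort r S; have pT : perm_eq T S by rewrite perm_sort.
have uT : uniq T by rewrite (perm_uniq pT).
have sT : size T = size S by apply: perm_size.
rewrite -(perm_big _ pT) /=.
case ET : T => [|x0 T']; first by rewrite big_nil -sT ET big_ord0.
rewrite -ET (big_nth x0) big_mkord sT.
have takeE (f : G -> R) k : (k <= size S)%N ->
    \sum_(i < k) f (nth x0 T i) = \sum_(x <- take k T) f x.
  rewrite -sT => kS; rewrite (big_nth x0) big_mkord size_takel//.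
  by apply: eq_bigr => i _; rewrite nth_take.
have dT (f : G -> R) (w : nat -> R) k : dominated f w -> (k <= size S)%N ->
    \sum_(i < k) f (nth x0 T i) <= \sum_(i < k) w i.
  move=> fw kS; rewrite takeE//; apply: le_trans (fw _ _) _.
    exact: take_uniq.
  by rewrite size_takel// sT.
apply: (@le_trans _ _ (\sum_(i < size S) g i * h (nth x0 T i))).
  have [n0 | nz] := posnP (size S); first by rewrite n0 !big_ord0.
  apply: (@ler_sum_abel _ (fun i => c (nth x0 T i)) g (fun i => h (nth x0 T i))) => //.
  - by move=> k; apply: dT.
  - move=> i iS; have /(sortedP x0) : sorted r T by apply: sort_sorted.
    by apply; rewrite sT.
have := @ler_sum_abel _ (fun i => h (nth x0 T i)) eta g (fun k => dT h eta k he)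
  g0 (fun i _ => gd i).
by rewrite !(eq_bigr _ (fun i _ => mulrC (g _) _)).
Qed.

End rearrangement_sequences.

(* Bounds the number of pairs of a k-set and an l-set with sum in a j-set. *)
Fixpoint hook_sum (k l j : nat) : nat :=
  match k, l with
  | k'.+1, l'.+1 => (minn j (k' + l').+1 + hook_sum k' l' j)%N
  | _, _ => 0%N
  end.

(** * Counting the pairs with sum in a given set *)

Section sums_in_a_set.
Context (G : realDomainType).
Implicit Types K L J : seq G.

Let pairs K L J := (\sum_(x <- K) \sum_(y <- L) ((x + y)%R \in J))%N.

(* The hook made of x0 = max K and y0 = min L has pairwise distinct sums. *)
Let pairs_sorted K L J : uniq J -> sorted >%O K -> sorted <%O L ->
  (pairs K L J <= hook_sum (size K) (size L) (size J))%N.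
Proof.
move=> uJ; elim: K L => [|x0 K IH] [|y0 L] sK sL.
- by rewrite /pairs big_nil.
- by rewrite /pairs big_nil.
- by rewrite /pairs; under eq_bigr do rewrite big_nil; rewrite big1_eq.
have trg : transitive (>%O : rel G) by move=> y x z xy yz; apply: lt_trans xy.
have trl : transitive (<%O : rel G) by move=> y x z xy yz; apply: lt_trans yz.
have /andP[aK sK'] : all (>%O x0) K && sorted >%O K.
  by have := sK; rewrite /= (path_sortedE trg).
have /andP[aL sL'] : all (<%O y0) L && sorted <%O L.
  by have := sL; rewrite /= (path_sortedE trl).
pose H := [seq x0 + y | y <- y0 :: L] ++ [seq x + y0 | x <- K].
have ltP : {in K, forall x, x < x0} by move=> x /(allP aK).
have gtP : {in L, forall y, y0 < y} by move=> x /(allP aL).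
have uH : uniq H.
  rewrite cat_uniq !map_inj_uniq; [|exact: addIr|exact: addrI].
  rewrite (sorted_uniq trl (@ltxx _ _) sL) (sorted_uniq trg (@ltxx _ _) sK') andbT /=.
  apply/hasPn => z /mapP[x xK ->]; apply/negP => /(@mapP _ _ _ (y0 :: L))[y yL].
  have := ltP _ xK; move: yL; rewrite inE => /orP[/eqP-> | /gtP]; lra.
have -> : pairs (x0 :: K) (y0 :: L) J = (count (mem J) H + pairs K L J)%N.
  rewrite /pairs big_cons /H count_cat !count_map -addnA; congr addn.
    by rewrite -sumn_count sumnE big_map.
  under eq_bigr do rewrite big_cons.
  by rewrite big_split /= -sumn_count sumnE big_map.
apply: (@leq_add _ _ (minn _ (size K + size L).+1)); last exact: IH.
rewrite leq_min; apply/andP; split.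
  rewrite -size_filter; apply: uniq_leq_size; first exact: filter_uniq.
  by move=> z; rewrite mem_filter => /andP[].
by apply: leq_trans (count_size _ _) _; rewrite /H size_cat /= !size_map; lia.
Qed.

Lemma pairs_le_hook_sum K L J : uniq K -> uniq L -> uniq J ->
  (\sum_(x <- K) \sum_(y <- L) ((x + y)%R \in J) <=
   hook_sum (size K) (size L) (size J))%N.
Proof.
move=> uK uL uJ.
have pK : perm_eq (rev (sort <=%O K)) K by rewrite perm_rev perm_sort.
have pL : perm_eq (sort <=%O L) L by rewrite perm_sort.
rewrite -(perm_size pK) -(perm_size pL) -(perm_big _ pK) /=.
under eq_bigr do rewrite -(perm_big _ pL) /=.
apply: pairs_sorted => //.
  by rewrite rev_sorted sort_lt_sorted.
by rewrite sort_lt_sorted.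
Qed.

End sums_in_a_set.

(* The enumeration 0, 1, -1, 2, -2, .. of the integers. *)
Definition zigzag (i : nat) : int :=
  if odd i then Posz i.+1./2 else - Posz i./2.

Lemma zigzag_inj : injective zigzag.
Proof.
move=> i j; rewrite /zigzag => /eqP.
case: ifP => oi; case: ifP => oj /eqP ?; lia.
Qed.

Lemma zigzagN (p : nat) : zigzag p.*2.+1 = - zigzag p.*2.+2.
Proof. by rewrite /zigzag /= negbK odd_double /=; lia. Qed.

(** Initial segments of [zigzag] are intervals that grow by one point, on the right and on the left
    in turn. *)
Lemma big_zigzag (V : nmodType) (F : int -> V) (l : nat) :
  \sum_(i < l) F (zigzag i) =
  \sum_(i < l) F (Posz i - Posz l.-1./2).
Proof.
elim: l => [|l IH]; first by rewrite !big_ord0.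
rewrite big_ord_recr /= IH /zigzag; case: ifP => ol.
  rewrite [RHS]big_ord_recr /=; congr (_ + F _); last by lia.
  by apply: eq_bigr => i _; congr F; lia.
rewrite addrC [RHS]big_ord_recl /=; congr (F _ + _); first by lia.
apply: eq_bigr => i _; congr F; rewrite /bump /=.
by have := ltn_ord i; lia.
Qed.

Lemma zigzag_range (p : nat) (x : int) :
  (x \in [seq zigzag i | i <- iota 0 p.*2.+1]) = (`|x| <= p%:Z).
Proof.
apply/mapP/idP => [[i] | xp].
  by rewrite mem_iota /zigzag => ip ->; case: ifP => _; lia.
have [x0 | x0] := ltrP 0 x.
  by exists (`|x|%N.*2.-1)%N; [rewrite mem_iota; lia | rewrite /zigzag; case: ifP => ?; lia].
by exists (`|x|%N.*2)%N; [rewrite mem_iota; lia | rewrite /zigzag; case: ifP => ?; lia].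
Qed.

(** The right-hand side is the length of the intersection of [s, s + n) with [-p, p + 1). *)
Lemma count_ball_interval (s : int) (n p : nat) :
  (\sum_(t < n) (`|s + t%:Z| <= p%:Z)%R)%N%:Z =
  Num.max 0 (Num.min (s + n%:Z) (p%:Z + 1) - Num.max s (- p%:Z)).
Proof.
elim: n => [|n IH]; first by rewrite big_ord0; lia.
rewrite big_ord_recr /= PoszD IH.
case: (boolP (`|s + n%:Z| <= p%:Z)) => /= H; lia.
Qed.

(** The hypothesis says that the two intervals have centres at most 1/2 apart. The hook made of
    their last points has consecutive integers as differences, a window centred within 1/2 of 0,
    which therefore meets [-p, p] in as many points as its length allows. Removing both last points
    moves both centres by 1/2, so the hypothesis persists. *)
Lemma hook_sum_interval (p k l : nat) (i0 l0 : int) :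
  `|i0 *+ 2 + k%:Z - (l0 *+ 2 + l%:Z)| <= 1 ->
  (\sum_(b < k) \sum_(i < l) (`|(b%:Z + i0) - (i%:Z + l0)| <= p%:Z)%R)%N =
  hook_sum k l p.*2.+1.
Proof.
elim: k l => [|k IH] [|l] D.
- by rewrite big_ord0.
- by rewrite big_ord0.
- by under eq_bigr do rewrite big_ord0; rewrite big1_eq.
rewrite big_ord_recr /=; under eq_bigr do rewrite big_ord_recr /=.
rewrite big_split /= IH; last by lia.
rewrite -addnA addnC; congr addn.
rewrite -[RHS](_ : (\sum_(t < (k + l.+1)) (`|(i0 - l0 - l%:Z) + t%:Z| <= p%:Z)%R)%N = _).
  rewrite big_split_ord /=; congr addn.
    by apply: eq_bigr => i _; congr (nat_of_bool (_ <= _)); lia.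
  rewrite (reindex_inj rev_ord_inj) /=; apply: eq_bigr => i _.
  by congr (nat_of_bool (_ <= _)); have := ltn_ord i; lia.
rewrite addnS.
by apply/eqP; rewrite -eqz_nat count_ball_interval; apply/eqP; lia.
Qed.

(** The case of equality in [pairs_le_hook_sum]. An initial segment of [zigzag] is centred at 0 or
    at 1/2; differences of two such segments are centred within 1/2 of 0, while sums could be off by
    1. This is the origin of [oppm xi] in [odd_dominated_conv]. *)
Lemma hook_sum_zigzag (p k l : nat) :
  (\sum_(b < k) \sum_(i < l) (`|zigzag b - zigzag i| <= p%:Z)%R)%N =
  hook_sum k l p.*2.+1.
Proof.
case: k => [|k]; first by rewrite big_ord0.
case: l => [|l]; first by under eq_bigr do rewrite big_ord0; rewrite big1_eq.
rewrite (@big_zigzag nat (fun z => \sum_(i < l.+1) (`|z - zigzag i| <= p%:Z)%R)%N).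
under eq_bigr => b _.
  rewrite (@big_zigzag nat (fun z => (`|(b%:Z - (k.+1.-1)./2%:Z) - z| <= p%:Z)%R : nat)).
  over.
apply: hook_sum_interval; lia.
Qed.

(* A finitely supported measure on G is a list of weighted points. *)
Section weighted_lists.
Context (R : realFieldType) (G : realDomainType).
Implicit Types (mu nu : seq (R * G)) (f g : G -> R).

Definition wsum mu f := \sum_(q <- mu) q.1 * f q.2.
Definition mass mu (y : G) := wsum mu (fun x => (x == y)%:R).
Definition wconv mu nu := [seq (p.1 * q.1, p.2 + q.2) | p <- mu, q <- nu].
Definition oppm mu := [seq (q.1, - q.2) | q <- mu].
Definition symm mu := wconv mu (oppm mu).
Definition unitm : seq (R * G) := [:: (1, 0)].
Definition convs (mus : seq (seq (R * G))) := foldr wconv unitm mus.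
(** Agrees with [symm (convs mus)] by [wsum_symms]; the factorwise form lets an induction convolve
    one even law at a time. *)
Definition symms (mus : seq (seq (R * G))) :=
  foldr (fun mu nu => wconv (symm mu) nu) unitm mus.
Definition nonneg mu := all (fun q => 0 <= q.1) mu.

Lemma eq_wsum mu f g : f =1 g -> wsum mu f = wsum mu g.
Proof. by move=> fg; apply: eq_bigr => q _; rewrite fg. Qed.

Lemma wsum_wconv mu nu f :
  wsum (wconv mu nu) f = wsum mu (fun x => wsum nu (fun y => f (x + y))).
Proof.
rewrite /wsum /wconv big_allpairs_dep /=; apply: eq_bigr => p _.
by rewrite mulr_sumr; apply: eq_bigr => q _; rewrite mulrA.
Qed.

Lemma wsum_oppm mu f : wsum (oppm mu) f = wsum mu (fun x => f (- x)).
Proof. by rewrite /wsum big_map. Qed.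

Lemma wsum_unitm f : wsum unitm f = f 0.
Proof. by rewrite /wsum big_seq1 mul1r. Qed.

Lemma wsum_exchange mu nu (f : G -> G -> R) :
  wsum mu (fun x => wsum nu (f x)) = wsum nu (fun y => wsum mu (f^~ y)).
Proof.
rewrite /wsum; under eq_bigr do rewrite mulr_sumr.
rewrite exchange_big; apply: eq_bigr => q _ /=.
by rewrite mulr_sumr; apply: eq_bigr => p _; rewrite mulrCA.
Qed.

Lemma wsum_sum (I : Type) (r : seq I) mu (f : I -> G -> R) :
  wsum mu (fun x => \sum_(i <- r) f i x) = \sum_(i <- r) wsum mu (f i).
Proof.
rewrite /wsum exchange_big; apply: eq_bigr => q _; exact: mulr_sumr.
Qed.

Lemma wsumZ mu (a : R) f : wsum mu (fun x => a * f x) = a * wsum mu f.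
Proof. by rewrite /wsum mulr_sumr; apply: eq_bigr => q _; rewrite mulrCA. Qed.

Lemma ler_wsum mu f g : nonneg mu -> (forall x, f x <= g x) ->
  wsum mu f <= wsum mu g.
Proof.
move=> /allP mu0 fg; rewrite /wsum big_seq [leRHS]big_seq.
by apply: ler_sum => q /mu0 q0; apply: ler_wpM2l.
Qed.

Lemma wsum_ge0 mu f : nonneg mu -> (forall x, 0 <= f x) -> 0 <= wsum mu f.
Proof.
move=> /allP mu0 f0; rewrite /wsum big_seq.
by apply: sumr_ge0 => q /mu0 q0; apply: mulr_ge0.
Qed.

Lemma nonneg_wconv mu nu : nonneg mu -> nonneg nu -> nonneg (wconv mu nu).
Proof.
move=> /allP mu0 /allP nu0; apply/allP => _ /allpairsP[[p q] [/= pm qn ->]] /=.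
by apply: mulr_ge0; [apply: mu0|apply: nu0].
Qed.

Lemma nonneg_oppm mu : nonneg mu -> nonneg (oppm mu).
Proof. by rewrite /nonneg /oppm all_map. Qed.

Lemma nonneg_symm mu : nonneg mu -> nonneg (symm mu).
Proof. by move=> mu0; rewrite nonneg_wconv ?nonneg_oppm. Qed.

Lemma nonneg_unitm : nonneg unitm. Proof. by rewrite /= ler01. Qed.

Lemma nonneg_symms mus : all nonneg mus -> nonneg (symms mus).
Proof.
elim: mus => [_|mu mus IH /andP[? ?]]; first exact: nonneg_unitm.
by rewrite nonneg_wconv ?IH ?nonneg_symm.
Qed.

Lemma mass_ge0 mu y : nonneg mu -> 0 <= mass mu y.
Proof. by move=> mu0; apply: wsum_ge0 => // x; apply: ler0n. Qed.

Lemma sum_mass mu (K : seq G) : uniq K ->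
  \sum_(y <- K) mass mu y = wsum mu (fun x => (x \in K)%:R).
Proof.
move=> uK; rewrite -wsum_sum; apply: eq_wsum => x.
case: (boolP (x \in K)) => xK.
  rewrite (bigD1_seq x) //= eqxx big1 ?addr0 // => y.
  by rewrite eq_sym => /negbTE->.
rewrite big1_seq // => y /andP[_ yK].
by case: eqP => // xy; rewrite xy yK in xK.
Qed.

Lemma wsum_mass mu f (S : seq G) : uniq S ->
  {subset [seq q.2 | q <- mu] <= S} ->
  wsum mu f = \sum_(y <- S) mass mu y * f y.
Proof.
move=> uS mS.
have -> : \sum_(y <- S) mass mu y * f y =
    wsum mu (fun x => \sum_(y <- S) (x == y)%:R * f y).
  rewrite wsum_sum; apply: eq_bigr => y _; rewrite mulrC -wsumZ.
  by apply: eq_wsum => x; rewrite mulrC.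
rewrite /wsum big_seq [RHS]big_seq; apply: eq_bigr => q qm; congr (_ * _).
have qS : q.2 \in S by apply: mS; apply: map_f.
rewrite (bigD1_seq q.2) //= eqxx mul1r big1 ?addr0 // => y.
by rewrite eq_sym => /negbTE->; rewrite mul0r.
Qed.

(** Regrouped by values, this is 2uv <= u^2 + v^2 at each point y of [S]. The set [S] contains the
    support of [mu], and its translate by x contains that of [nu]. *)
Lemma cauchy_wsum mu nu (x : G) :
  wsum mu (fun y => mass nu (x + y)) *+ 2 <=
  wsum mu (mass mu) + wsum nu (mass nu).
Proof.
pose S := undup ([seq q.2 | q <- mu] ++ [seq q.2 - x | q <- nu]).
have uS : uniq S by apply: undup_uniq.
have mS : {subset [seq q.2 | q <- mu] <= S}.
  by move=> y ym; rewrite mem_undup mem_cat ym.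
rewrite !(wsum_mass _ uS mS).
have uT : uniq [seq x + y | y <- S] by rewrite map_inj_uniq //; apply: addrI.
rewrite (wsum_mass _ uT); last first.
  move=> _ /mapP[q qn ->]; apply/mapP; exists (q.2 - x); last by lra.
  by rewrite mem_undup mem_cat; apply/orP; right; apply: map_f.
rewrite big_map -sumrMnl -big_split /=; apply: ler_sum => y _.
have := sqr_ge0 (mass mu y - mass nu (x + y)); rewrite expr2; nra.
Qed.

(** The support has at most [size mu] points. A common [N] replaces its exact size so that two
    nested applications share one range of summation. *)
Lemma wsum_pairing mu (h : G -> R) (g eta : nat -> R) (N : nat) :
  (size mu <= N)%N -> (forall x, 0 <= h x) -> (forall i, 0 <= g i) ->
  (forall i, 0 <= eta i) ->
  (forall i, g i.+1 <= g i) -> dominated (mass mu) g -> dominated h eta ->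
  wsum mu h <= \sum_(i < N) g i * eta i.
Proof.
move=> muN h0 g0 e0 gd mg he; set S := undup [seq q.2 | q <- mu].
rewrite (@wsum_mass _ _ S) ?undup_uniq //; last by move=> x; rewrite mem_undup.
apply: le_trans (@ler_sum_pairing _ _ _ h g eta S (undup_uniq _) _ _ _ _ _) _ => //.
have SN : (size S <= N)%N.
  by apply: leq_trans (size_undup _) _; rewrite size_map.
rewrite -(subnKC SN) big_split_ord /= lerDl.
by apply: sumr_ge0 => i _; apply: mulr_ge0.
Qed.

End weighted_lists.

(** * Laws of differences of independent copies *)

Section symmetrization.
Context (R : realFieldType) (G : realDomainType).
Implicit Types (mu nu : seq (R * G)) (f g : G -> R).

Lemma wsum_symm mu f :
  wsum (symm mu) f = wsum mu (fun x => wsum mu (fun y => f (x - y))).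
Proof. by rewrite wsum_wconv; apply: eq_wsum => x; rewrite wsum_oppm. Qed.

Lemma wsum_symm_even mu f :
  wsum (symm mu) (fun x => f (- x)) = wsum (symm mu) f.
Proof.
rewrite !wsum_symm wsum_exchange; apply: eq_wsum => x; apply: eq_wsum => y.
by rewrite opprB.
Qed.

Lemma wsum_symms (mus : seq (seq (R * G))) f :
  wsum (symms mus) f = wsum (symm (convs mus)) f.
Proof.
elim: mus f => [|mu mus IH] f /=.
  by rewrite wsum_symm !wsum_unitm subrr.
rewrite wsum_wconv !wsum_symm wsum_wconv; apply: eq_wsum => x.
under [RHS]eq_wsum do rewrite wsum_wconv.
rewrite [RHS]wsum_exchange; apply: eq_wsum => y.
rewrite IH wsum_symm; apply: eq_wsum => x'; apply: eq_wsum => y'.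
by congr f; ring.
Qed.

Lemma wsum_symms_even (mus : seq (seq (R * G))) f :
  wsum (symms mus) (fun x => f (- x)) = wsum (symms mus) f.
Proof. by rewrite !wsum_symms wsum_symm_even. Qed.

Lemma mass_symms_even (mus : seq (seq (R * G))) y :
  mass (symms mus) (- y) = mass (symms mus) y.
Proof.
rewrite /mass -wsum_symms_even; apply: eq_wsum => x.
by rewrite eqr_oppLR opprK.
Qed.

Lemma mass_symms0 (mus : seq (seq (R * G))) :
  mass (symms mus) 0 = wsum (convs mus) (mass (convs mus)).
Proof.
rewrite /mass wsum_symms wsum_symm; apply: eq_wsum => x; apply: eq_wsum => y.
by rewrite subr_eq0 eq_sym.
Qed.

(** An autocorrelation is largest at 0: [cauchy_wsum] compares the law of the sum with its own
    translate. *)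
Lemma mass_symms_max (mus : seq (seq (R * G))) y :
  mass (symms mus) y <= mass (symms mus) 0.
Proof.
have := cauchy_wsum (convs mus) (convs mus) (- y).
rewrite -mulr2n ler_pMn2r // mass_symms0; apply: le_trans.
rewrite {1}/mass wsum_symms wsum_symm le_eqVlt; apply/orP; left; apply/eqP.
apply: eq_wsum => x; apply: eq_wsum => z.
by congr (nat_of_bool _)%:R; apply/eqP/eqP => [<-|->]; ring.
Qed.

Lemma wsum_convs_cat (mus nus : seq (seq (R * G))) f :
  wsum (convs (mus ++ nus)) f =
  wsum (convs mus) (fun x => wsum (convs nus) (fun y => f (x + y))).
Proof.
elim: mus f => [|mu mus IH] f /=.
  by rewrite wsum_unitm; under [RHS]eq_wsum do rewrite add0r.
rewrite !wsum_wconv; apply: eq_wsum => x; rewrite IH.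
by apply: eq_wsum => y; apply: eq_wsum => z; rewrite addrA.
Qed.

(** S_A + S_B = x means -S_B = S_A - x, so [cauchy_wsum] applies to S_A and -S_B; reflection leaves
    the collision probability of S_B unchanged. *)
Lemma mass_convs_cat (mus nus : seq (seq (R * G))) x :
  mass (convs (mus ++ nus)) x *+ 2 <=
  mass (symms mus) 0 + mass (symms nus) 0.
Proof.
have := cauchy_wsum (convs mus) (oppm (convs nus)) (- x).
have -> : wsum (oppm (convs nus)) (mass (oppm (convs nus))) =
    wsum (convs nus) (mass (convs nus)).
  rewrite wsum_oppm; apply: eq_wsum => y; rewrite /mass wsum_oppm.
  by apply: eq_wsum => z; rewrite (inj_eq oppr_inj).
rewrite -!mass_symms0; apply: le_trans; rewrite ler_pMn2r //.
rewrite {1}/mass wsum_convs_cat le_eqVlt; apply/orP; left; apply/eqP.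
apply: eq_wsum => y; rewrite /mass wsum_oppm; apply: eq_wsum => z.
by congr (nat_of_bool _)%:R; rewrite eqr_oppLR; apply/eqP/eqP => [<-|->]; ring.
Qed.

End symmetrization.

Section dominated_symmetric.
Context (R : realFieldType) (G : realDomainType).
Implicit Types (c : G -> R) (g : nat -> R).

Definition odd_dominated c g := forall K : seq G, uniq K -> odd (size K) ->
  \sum_(x <- K) c x <= \sum_(i < size K) g i.

Let symmetric_odd (K : seq G) : uniq K -> (forall x, (- x \in K) = (x \in K)) ->
  0 \in K -> odd (size K).
Proof.
move=> uK sK K0.
pose P := [seq x <- K | 0 < x]; pose N := [seq x <- K | x < 0].
have pN : perm_eq N [seq - x | x <- P].
  apply: uniq_perm; first exact: filter_uniq.
    by rewrite map_inj_uniq ?filter_uniq //; apply: oppr_inj.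
  move=> x; rewrite mem_filter; apply/andP/mapP => [[x0 xK]|[y]].
    by exists (- x); rewrite ?opprK // mem_filter sK oppr_gt0 x0.
  by rewrite mem_filter => /andP[y0 yK] ->; rewrite sK oppr_lt0.
have -> : size K = (size (0 :: (P ++ N))).
  apply: perm_size; apply: uniq_perm => //.
    rewrite /= cat_uniq !filter_uniq // mem_cat !mem_filter ltxx /= andbT.
    by apply/hasPn => x; rewrite !mem_filter => /andP[x0 _]; rewrite negb_and -leNgt ltW.
  move=> x; rewrite inE mem_cat !mem_filter -andb_orl.
  by case: ltrgt0P => //= ->.
by rewrite /= size_cat (perm_size pN) size_map addnn odd_double.
Qed.

(* A set K of even size containing 0 is compared with K :&: -K and K :|: -K,
   which are symmetric and hence of odd sizes, with mean size that of K. *)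
Lemma dominated_of_odd c g :
  (forall x, c (- x) = c x) -> (forall x, c x <= c 0) ->
  (forall i, g i.+1 <= g i) ->
  odd_dominated c g -> dominated c g.
Proof.
move=> cN c0 gd od.
(* Partial sums of a nonincreasing sequence are concave in their length; this compares the sizes of
   [I] and [U] below with their mean, the size of [K]. *)
have concave p d : (d <= p)%N ->
    \sum_(i < (p.+1 + d)) g i + \sum_(i < (p.+1 - d)) g i <=
    (\sum_(i < p.+1) g i) *+ 2.
  elim: d => [|d IH] dp; first by rewrite addn0 subn0 mulr2n.
  have := IH (ltnW dp).
  have -> : \sum_(i < (p.+1 + d.+1)) g i = \sum_(i < (p.+1 + d)) g i + g (p.+1 + d)%N.
    by rewrite addnS big_ord_recr.
  have -> : \sum_(i < (p.+1 - d)) g i = \sum_(i < (p.+1 - d.+1)) g i + g (p - d)%N.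
    rewrite (_ : (p.+1 - d)%N = (p - d).+1) ?big_ord_recr /= ?subSS //; lia.
  have : g (p.+1 + d)%N <= g (p - d)%N.
    have gm n m : g (n + m)%N <= g n.
      elim: m => [|m IHm]; rewrite ?addn0 // addnS; exact: le_trans IHm.
    by rewrite (_ : (p.+1 + d)%N = (p - d + d.*2.+1)%N) //; lia.
  lra.
have with0 (K : seq G) : uniq K -> ~~ odd (size K) -> 0 \in K ->
    \sum_(x <- K) c x <= \sum_(i < size K) g i.
  move=> uK eK K0.
  pose N := [seq - x | x <- K].
  have uN : uniq N by rewrite map_inj_uniq //; apply: oppr_inj.
  have memN x : (x \in N) = (- x \in K).
    by apply/mapP/idP => [[y yK ->]|xK]; [rewrite opprK|exists (- x); rewrite ?opprK].
  pose I := [seq x <- K | x \in N]; pose U := K ++ [seq x <- N | x \notin K].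
  have uI : uniq I by apply: filter_uniq.
  have uU : uniq U.
    rewrite cat_uniq uK filter_uniq // andbT.
    by apply/hasPn => x; rewrite mem_filter => /andP[].
  have oI : odd (size I).
    apply: symmetric_odd => // [x|]; rewrite !mem_filter !memN ?opprK ?oppr0 ?K0 //.
    by rewrite andbC.
  have oU : odd (size U).
    apply: symmetric_odd => // [x|]; rewrite !mem_cat ?K0 // !mem_filter !memN ?opprK.
    by case: (x \in K); case: (- x \in K).
  have IN : perm_eq I [seq x <- N | x \in K].
    apply: uniq_perm => //; first exact: filter_uniq.
    by move=> x; rewrite !mem_filter andbC.
  have sIU : (size I + size U = (size K).*2)%N.
    rewrite size_cat (perm_size IN) addnCA -addnn; congr addn.
    by rewrite !size_filter count_predC size_map.
  have cIU : \sum_(x <- I) c x + \sum_(x <- U) c x = (\sum_(x <- K) c x) *+ 2.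
    rewrite big_cat /= (perm_big _ IN) /= addrCA mulr2n; congr +%R.
    rewrite !big_filter; transitivity (\sum_(x <- N) c x).
      by rewrite [RHS](bigID (mem K)).
    by rewrite big_map; apply: eq_bigr => x _; rewrite cN.
  have := od _ uI oI; have := od _ uU oU.
  have sI : (size I <= size K)%N by rewrite size_filter count_size.
  have [q Kq] : exists q, size K = q.+1 by case: (K) K0 => // ? s _; exists (size s).
  have := @concave q (size K - size I)%N.
  have -> : (q.+1 + (size K - size I))%N = size U by lia.
  have -> : (q.+1 - (size K - size I))%N = size I by lia.
  have -> : (size K - size I <= q)%N by rewrite -ltnS -Kq; lia.
  rewrite -Kq => /(_ isT) H1 H2 H3; rewrite -(@ler_pMn2r _ 2) // -cIU; lra.
move=> K uK; case: (boolP (odd (size K))) => [|eK]; first exact: od.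
case: (boolP (0 \in K)) => [|K0]; first exact: with0.
(* A set of even size without 0 reduces to the previous case: trading one of its points for 0 cannot
   lower the sum, since [c] is largest at 0. *)
case: K uK eK K0 => [|x K]; first by rewrite !big_nil big_ord0.
move=> /= /andP[xK uK] eK; rewrite inE negb_or => /andP[x0 K0].
have := with0 (0 :: K); rewrite /= K0 uK inE eqxx !big_cons => /(_ isT eK isT).
by apply: le_trans; rewrite lerD2r.
Qed.

End dominated_symmetric.

(** * The Riesz type inequality and its iteration *)

Section rearrangement_of_convolutions.
Context (R : realFieldType).

(** [wsum_pairing] is used for [nu], then, inside the domination that it asks for, for [mu]. This
    replaces both laws by sets [L] and [M], and what remains is the number of pairs with sum in [K],
    for which [zigzag] is extremal. *)
Lemma odd_mass_conv (G : realDomainType) (mu nu : seq (R * G)) (g e : nat -> R)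
    (p N : nat) (K : seq G) :
  (size mu <= N)%N -> (size nu <= N)%N -> nonneg mu -> nonneg nu ->
  (forall i, 0 <= g i) -> (forall i, 0 <= e i) ->
  (forall i, g i.+1 <= g i) -> (forall i, e i.+1 <= e i) ->
  dominated (mass mu) g -> dominated (mass nu) e ->
  uniq K -> size K = p.*2.+1 ->
  wsum (wconv mu nu) (fun x => (x \in K)%:R) <=
  \sum_(i < N) e i *
    \sum_(a < N) g a * (`|zigzag a - zigzag i| <= p%:Z)%R%:R.
Proof.
move=> muN nuN mu0 nu0 g0 e0 gd ed mg ne uK sK.
rewrite wsum_wconv wsum_exchange.
apply: (@wsum_pairing R G nu (fun y => wsum mu (fun x => (x + y \in K)%:R)) e
  (fun i => \sum_(a < N) g a * (`|zigzag a - zigzag i| <= p%:Z)%R%:R)) => //.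
- by move=> x; apply: wsum_ge0 => // y; apply: ler0n.
- by move=> i; apply: sumr_ge0 => a _; rewrite mulr_ge0 ?ler0n.
move=> L uL; rewrite -wsum_sum exchange_big /=.
under [leRHS]eq_bigr do rewrite -mulr_sumr.
apply: (@wsum_pairing R G mu (fun x => \sum_(y <- L) (x + y \in K)%:R) g
  (fun a => \sum_(i < size L) (`|zigzag a - zigzag i| <= p%:Z)%R%:R)) => //.
- by move=> x; apply: sumr_ge0.
- by move=> x; apply: sumr_ge0.
move=> M uM.
have := pairs_le_hook_sum uM uL uK; rewrite sK -hook_sum_zigzag -(ler_nat R).
rewrite !natr_sum => H.
apply: le_trans (le_trans _ H) _.
  by apply: ler_sum => x _; rewrite natr_sum.
by apply: ler_sum => x _; rewrite natr_sum.
Qed.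

Lemma zigzag_surj (s : seq int) :
  exists N, forall n, (N <= n)%N -> {subset s <= [seq zigzag i | i <- iota 0 n]}.
Proof.
exists (\max_(x <- s) `|x|%N).*2.+1 => n Nn x xs.
have : x \in [seq zigzag i | i <- iota 0 (\max_(x <- s) `|x|%N).*2.+1].
  rewrite zigzag_range -abszE lez_nat.
  by rewrite (big_rem x xs) /=; apply: leq_maxl.
case/mapP => i iN ->; apply: map_f; move: iN; rewrite !mem_iota; lia.
Qed.

(** Once the first N terms of [zigzag] cover both supports, each side is the total weight of the
    pairs at distance at most p. *)
Lemma bilinear_zigzag (zeta xi : seq (R * int)) (p : nat) :
  exists N0, forall N, (N0 <= N)%N ->
  \sum_(i < N) mass xi (zigzag i) *
    \sum_(a < N) mass zeta (zigzag a) * (`|zigzag a - zigzag i| <= p%:Z)%R%:R =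
  \sum_(i < p.*2.+1) mass (wconv zeta (oppm xi)) (zigzag i).
Proof.
have [N1 H1] := zigzag_surj [seq q.2 | q <- zeta].
have [N2 H2] := zigzag_surj [seq q.2 | q <- xi].
exists (maxn N1 N2) => N; rewrite geq_max => /andP[N1N N2N].
have uZ n : uniq [seq zigzag i | i <- iota 0 n].
  by rewrite map_inj_uniq ?iota_uniq //; apply: zigzag_inj.
have sumZ n (f : int -> R) :
    \sum_(i < n) f (zigzag i) = \sum_(y <- [seq zigzag i | i <- iota 0 n]) f y.
  by rewrite big_map -[in RHS](subn0 n) big_mkord.
rewrite [RHS](@sumZ _ (mass _)) sum_mass // wsum_wconv wsum_exchange wsum_oppm.
rewrite (@sumZ N (fun y => mass xi y * \sum_(a < N) mass zeta (zigzag a) *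
  (`|zigzag a - y| <= p%:Z)%R%:R)).
rewrite -wsum_mass //; last exact: H2.
apply: eq_wsum => y.
rewrite (@sumZ N (fun x => mass zeta x * (`|x - y| <= p%:Z)%R%:R)).
rewrite -wsum_mass //; last exact: H1.
by apply: eq_wsum => x; rewrite zigzag_range.
Qed.

Lemma odd_dominated_conv (zeta xi : seq (R * int)) (G : realDomainType)
    (mu nu : seq (R * G)) :
  nonneg zeta -> nonneg xi -> nonneg mu -> nonneg nu ->
  (forall i, mass zeta (zigzag i.+1) <= mass zeta (zigzag i)) ->
  (forall i, mass xi (zigzag i.+1) <= mass xi (zigzag i)) ->
  dominated (mass mu) (mass zeta \o zigzag) ->
  dominated (mass nu) (mass xi \o zigzag) ->
  odd_dominated (mass (wconv mu nu)) (mass (wconv zeta (oppm xi)) \o zigzag).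
Proof.
move=> z0 x0 mu0 nu0 zd xd mz nx K uK oK; rewrite sum_mass //.
have [p sK] : exists p, size K = p.*2.+1.
  by exists (size K)./2; rewrite -[LHS]odd_double_half oK.
have [N0 HN] := bilinear_zigzag zeta xi p.
pose N := maxn N0 (maxn (size mu) (size nu)).
rewrite sK /= -(HN N) ?leq_maxl //.
apply: (odd_mass_conv (g := mass zeta \o zigzag) (e := mass xi \o zigzag)) => //;
  rewrite ?/N; try lia.
- by move=> i; apply: mass_ge0.
- by move=> i; apply: mass_ge0.
Qed.

(** For odd i the two points are opposite and [c] is even. For even i, domination is tested on the
    first i + 1 points of [zigzag] with the last one replaced by its successor, a set of odd
    size. *)
Lemma noninc_zigzag (c : int -> R) :
  (forall x, c (- x) = c x) -> odd_dominated c (c \o zigzag) ->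
  forall i, c (zigzag i.+1) <= c (zigzag i).
Proof.
move=> cN od i; case: (boolP (odd i)) => oi.
  rewrite (_ : i = i./2.*2.+1); last by have := odd_double_half i; rewrite oi.
  by rewrite -[zigzag _.+2]opprK -zigzagN cN.
have := od [seq zigzag j | j <- i.+1 :: iota 0 i]; rewrite map_inj_uniq; last first.
  exact: zigzag_inj.
rewrite /= mem_iota iota_uniq size_map size_iota big_cons big_map oi.
have -> : ~~ (0 <= i.+1 < 0 + i)%N && true by lia.
rewrite -[in iota _ _](subn0 i) big_mkord big_ord_recr /= => /(_ isT isT); lra.
Qed.

Section symmetrizations.
Context (zu : seq (R * int)).
Hypothesis zu_ge0 : nonneg zu.
Hypothesis zu_noninc : forall i, mass zu (zigzag i.+1) <= mass zu (zigzag i).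
Hypothesis zu_dom : dominated (mass zu) (mass zu \o zigzag).

Let D (G : realDomainType) (mu : seq (R * G)) :=
  nonneg mu /\ dominated (mass mu) (mass zu \o zigzag).

Let dominated_oppm (G : realDomainType) (mu : seq (R * G)) :
  dominated (mass mu) (mass zu \o zigzag) ->
  dominated (mass (oppm mu)) (mass zu \o zigzag).
Proof.
move=> mz K uK; rewrite sum_mass // wsum_oppm.
have := mz [seq - x | x <- K]; rewrite map_inj_uniq ?size_map; last exact: oppr_inj.
move=> /(_ uK); apply: le_trans; rewrite sum_mass; last first.
  by rewrite map_inj_uniq //; apply: oppr_inj.
rewrite le_eqVlt; apply/orP; left; apply/eqP/eq_wsum => x.
by rewrite -{2}[x]opprK mem_map //; apply: oppr_inj.
Qed.

Let symm1 (G : realDomainType) (mu : seq (R * G)) f :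
  wsum (symm mu) f = wsum (symms [:: mu]) f.
Proof. by rewrite /= wsum_wconv; apply: eq_wsum => x; rewrite wsum_unitm addr0. Qed.

Let gsymm := mass (symm zu) \o zigzag.

Let symm_odd (G : realDomainType) (mu : seq (R * G)) : D mu ->
  odd_dominated (mass (symm mu)) gsymm.
Proof.
by move=> [mu0 mud]; apply: odd_dominated_conv => //;
  [apply: nonneg_oppm|apply: dominated_oppm].
Qed.

Let symm_even (G : realDomainType) (mu : seq (R * G)) x :
  mass (symm mu) (- x) = mass (symm mu) x.
Proof. by rewrite /mass !symm1; apply: mass_symms_even. Qed.

Let gsymm_noninc i : gsymm i.+1 <= gsymm i.
Proof. by apply: noninc_zigzag => //; apply: symm_odd. Qed.

Let symm_dom (G : realDomainType) (mu : seq (R * G)) : D mu ->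
  dominated (mass (symm mu)) gsymm.
Proof.
move=> Dmu; apply: dominated_of_odd => //; last exact: symm_odd.
by move=> x; rewrite /mass !symm1; apply: mass_symms_max.
Qed.

(* The extremal sequence is nonincreasing because its own law, on the integers,
   satisfies the odd case of the domination. *)
Lemma dominated_symms (k : nat) :
  (forall i, mass (symms (nseq k zu)) (zigzag i.+1) <=
             mass (symms (nseq k zu)) (zigzag i)) /\
  (forall (G : realDomainType) (mus : seq (seq (R * G))), size mus = k ->
    (forall mu, mu \in mus ->
      nonneg mu /\ dominated (mass mu) (mass zu \o zigzag)) ->
    dominated (mass (symms mus)) (mass (symms (nseq k zu)) \o zigzag)).
Proof.
have nnz j : nonneg (symms (nseq j zu)).
  by apply: nonneg_symms; rewrite all_nseq zu_ge0 orbT.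
elim: k => [|k [IHd IH]].
  split=> [i|G [|//] _ _ K uK] /=.
    rewrite /mass !wsum_unitm -[0]/(zigzag 0) !(inj_eq zigzag_inj) /=.
    exact: ler0n.
  rewrite sum_mass // wsum_unitm /=.
  case: K uK => [|x K] uK; first by rewrite big_ord0.
  rewrite big_ord_recl /= /mass wsum_unitm eqxx -[leLHS]addr0 lerD //.
    by rewrite lern1 leq_b1.
  by apply: sumr_ge0 => i _; rewrite wsum_unitm.
have od (G : realDomainType) (mus : seq (seq (R * G))) : size mus = k.+1 ->
    (forall mu, mu \in mus -> D mu) ->
    odd_dominated (mass (symms mus)) (mass (symms (nseq k.+1 zu)) \o zigzag).
  case: mus => [//|mu mus] [sm] Dm.
  have Dmu : D mu by apply: Dm; rewrite mem_head.
  have Dmus nu : nu \in mus -> D nu by move=> nm; apply: Dm; rewrite inE nm orbT.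
  have := @odd_dominated_conv (symm zu) (symms (nseq k zu)) G (symm mu) (symms mus).
  move=> H K uK oK; rewrite /= .
  (* The inequality for one convolution reflects its second law; an even law is unchanged by this,
     so the extremal sequence keeps its form. *)
  have -> : \sum_(i < size K) mass (wconv (symm zu) (symms (nseq k zu))) (zigzag i) =
     \sum_(i < size K) (mass (wconv (symm zu) (oppm (symms (nseq k zu)))) \o zigzag) i.
    apply: eq_bigr => i _; rewrite /= /mass !(wsum_wconv (symm zu)).
    apply: eq_wsum => x; rewrite wsum_oppm.
    exact: esym (wsum_symms_even _ (fun y => (x + y == zigzag i)%:R)).
  apply: H => //.
  - exact: nonneg_symm.
  - by apply: nonneg_symm; case: Dmu.
  - by apply: nonneg_symms; apply/allP => nu /Dmus[].
  - exact: symm_dom.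
  - exact: IH.
have noninc := noninc_zigzag (@mass_symms_even _ _ (nseq k.+1 zu)) (od _ _ _ _).
split.
  apply: noninc; first by rewrite size_nseq.
  by move=> mu /nseqP[->].
move=> G mus sm Dm; apply: dominated_of_odd.
- exact: mass_symms_even.
- exact: mass_symms_max.
- apply: noninc; first by rewrite size_nseq.
  by move=> mu /nseqP[->].
- exact: od.
Qed.

Lemma mass_symms_le (G : realDomainType) (mus : seq (seq (R * G))) :
  (forall mu, mu \in mus ->
      nonneg mu /\ dominated (mass mu) (mass zu \o zigzag)) ->
  mass (symms mus) 0 <= mass (symms (nseq (size mus) zu)) 0.
Proof.
move=> Dm; have [_ H] := dominated_symms (size mus).
have := H _ _ (erefl _) Dm [:: 0] isT.
by rewrite big_seq1 big_ord_recl big_ord0 addr0.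
Qed.

(** An even number of laws splits into two equal halves. If the number is odd, the first law is
    averaged out, which is free because its total weight is at most 1. *)
Lemma mass_convs_le (G : realDomainType) (mus : seq (seq (R * G))) (x : G) :
  (forall mu, mu \in mus ->
      [/\ nonneg mu, wsum mu (fun=> 1) <= 1 &
          dominated (mass mu) (mass zu \o zigzag)]) ->
  mass (convs mus) x <= mass (symms (nseq (size mus)./2 zu)) 0.
Proof.
have even k (nus : seq (seq (R * G))) y : size nus = k.*2 ->
    (forall mu, mu \in nus ->
      [/\ nonneg mu, wsum mu (fun=> 1) <= 1 &
          dominated (mass mu) (mass zu \o zigzag)]) ->
    mass (convs nus) y <= mass (symms (nseq k zu)) 0.
  move=> sn Dn; rewrite -(@ler_pMn2r _ 2) //.
  rewrite -{1}(cat_take_drop k nus); apply: le_trans (mass_convs_cat _ _ _) _.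
  have half (nus' : seq (seq (R * G))) : size nus' = k -> {subset nus' <= nus} ->
      mass (symms nus') 0 <= mass (symms (nseq k zu)) 0.
    by move=> <- sub; apply: mass_symms_le => mu /sub/Dn[].
  rewrite mulr2n; apply: lerD; apply: half.
  - by rewrite size_takel //; lia.
  - by move=> mu /mem_take.
  - by rewrite size_drop; lia.
  - by move=> mu /mem_drop.
move=> Dm; have := odd_double_half (size mus).
case: (boolP (odd (size mus))) => _ /=; last by move=> /esym/even; apply.
case: mus Dm => [//|mu mus] Dm; rewrite add1n /= => -[/esym sm].
have [mu0 mu1 _] := Dm mu (mem_head _ _).
rewrite /mass wsum_wconv.
apply: le_trans (_ : wsum mu (fun=> mass (symms (nseq (uphalf (size mus)) zu)) 0 * 1) <= _).
  apply: ler_wsum => // y.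
  have -> : wsum (convs mus) (fun z => (y + z == x)%:R) = mass (convs mus) (x - y).
    apply: eq_wsum => z; congr (nat_of_bool _)%:R.
    by apply/eqP/eqP => [<-|->]; ring.
  rewrite mulr1; apply: even => // nu nm; apply: Dm.
  by rewrite inE nm orbT.
rewrite wsumZ -[leRHS]mulr1; apply: ler_wpM2l => //.
by apply: mass_ge0; apply: nonneg_symms; rewrite all_nseq zu_ge0 orbT.
Qed.

End symmetrizations.
End rearrangement_of_convolutions.

Section extremal_law.
Context (R : realType) (a : R).
Hypothesis a01 : 0 < a < 1.

Let m := Num.truncn a^-1.

(** The atoms of weight [a] fill an interval and the remaining weight is next to it, on the right or
    on the left according to the parity of the floor of 1/a. Thus this is the law of U up to
    translation and reflection. *)
Definition zigzag_U : seq (R * int) :=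
  [seq (U_pmf a i, zigzag i) | i <- iota 0 (Num.truncn a^-1).+1].

Lemma truncn_inv_bounds : m%:R * a <= 1 < m.+1%:R * a.
Proof.
have [a0 _] := andP a01.
have /truncn_itv/andP[h1 h2] : 0 <= a^-1 by rewrite invr_ge0 ltW.
by rewrite -ler_pdivlMr // -ltr_pdivrMr // div1r h1.
Qed.

Lemma truncn_inv_gt0 : (0 < m)%N.
Proof.
have [a0 a1] := andP a01; rewrite truncn_gt0; rewrite invf_ge1 //; exact: ltW.
Qed.

Lemma U_pmf_noninc i : U_pmf a i.+1 <= U_pmf a i.
Proof.
have [a0 _] := andP a01; have /andP[h1 h2] := truncn_inv_bounds.
rewrite /U_pmf -/m; case: (ltngtP i.+1 m) => im.
- by [].
- case: eqP => _; last by [].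
  by rewrite subr_ge0 mulrC.
- by move: h2; rewrite -natr1; lra.
Qed.

Lemma U_pmf_le i : U_pmf a i <= a.
Proof.
elim: i => [|i IH]; last exact: le_trans (U_pmf_noninc i) IH.
by rewrite /U_pmf truncn_inv_gt0.
Qed.

Lemma mass_zigzag_U i : mass zigzag_U (zigzag i) = U_pmf a i.
Proof.
rewrite /mass /wsum big_map -/m -[iota _ _]/(index_iota 0 m.+1) big_mkord /=.
under eq_bigr do rewrite (inj_eq zigzag_inj).
have [im | im] := ltnP i m.+1.
  rewrite (bigD1 (Ordinal im)) //= eqxx mulr1 big1 ?addr0 // => j.
  by rewrite -val_eqE /= => /negbTE->; rewrite mulr0.
rewrite big1 => [|j _].
  by rewrite /U_pmf -/m; case: ltngtP im.
by rewrite (_ : (j == i :> nat) = false) ?mulr0 //; have := ltn_ord j; lia.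
Qed.

Lemma sum_U_pmf_ge (n : nat) (t : R) : t <= 1 -> t <= a * n%:R ->
  t <= \sum_(i < n) U_pmf a i.
Proof.
move=> t1 tn; have [nm | mn] := leqP n m.
  apply: le_trans tn _; rewrite mulr_natr -[n in _ *+ n]card_ord -sumr_const.
  apply: ler_sum => i _; rewrite /U_pmf -/m (_ : (i < m)%N) //.
  exact: leq_trans (ltn_ord i) nm.
apply: le_trans t1 _; rewrite -(sum_U_pmf a) -/m -(subnKC mn) big_split_ord /= lerDl.
by apply: sumr_ge0 => i _; apply: U_pmf_ge0.
Qed.

Lemma nonneg_zigzag_U : nonneg zigzag_U.
Proof. by apply/allP => _ /mapP[i _ ->] /=; apply: U_pmf_ge0. Qed.

(** A set of k points has weight at most min(1, ka), and the first k values of [U_pmf] add up to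
    just that: U is as concentrated as the bound on atoms permits. *)
Lemma dominated_zigzag_U (G : realDomainType) (mu : seq (R * G)) :
  nonneg mu -> wsum mu (fun=> 1) <= 1 -> (forall y, mass mu y <= a) ->
  dominated (mass mu) (mass zigzag_U \o zigzag).
Proof.
move=> mu0 mu1 mua K uK; under [leRHS]eq_bigr do rewrite /= mass_zigzag_U.
apply: sum_U_pmf_ge.
  rewrite sum_mass //; apply: le_trans mu1; apply: ler_wsum => // x.
  by rewrite lern1 leq_b1.
rewrite mulr_natr -sum1_size -sumrMnr; apply: ler_sum => y _; exact: mua.
Qed.

Lemma wsum_zigzag_U f : wsum zigzag_U f = \sum_(i < m.+1) U_pmf a i * f (zigzag i).
Proof. by rewrite /wsum big_map -/m -[iota _ _]/(index_iota 0 m.+1) big_mkord. Qed.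

Lemma zigzag_surj1 (x : int) : exists i, x = zigzag i.
Proof.
have [N /(_ N (leqnn _))] := zigzag_surj [:: x].
by move=> /(_ _ (mem_head _ _))/mapP[i _ ->]; exists i.
Qed.

(* The probability that U_1 + .. + U_k = U'_1 + .. + U'_k for independent
   copies of U. *)
Definition collision (k : nat) : R := mass (symms (nseq k zigzag_U)) 0.

Theorem mass_convs_le_collision (G : realDomainType) (mus : seq (seq (R * G))) x :
  (forall mu, mu \in mus ->
    [/\ nonneg mu, wsum mu (fun=> 1) <= 1 & forall y, mass mu y <= a]) ->
  mass (convs mus) x <= collision (size mus)./2.
Proof.
move=> good; apply: mass_convs_le.
- exact: nonneg_zigzag_U.
- by move=> i; rewrite !mass_zigzag_U U_pmf_noninc.
- apply: dominated_zigzag_U; first exact: nonneg_zigzag_U.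
    rewrite wsum_zigzag_U; under eq_bigr do rewrite mulr1.
    by rewrite sum_U_pmf.
  by move=> y; have [i ->] := zigzag_surj1 y; rewrite mass_zigzag_U U_pmf_le.
- by move=> mu /good[? ? ?]; split => //; apply: dominated_zigzag_U.
Qed.

End extremal_law.

(** * Asymptotics of the collision probability *)

Section cosine_transform.
Context (R : realType).
Implicit Types (zeta xi mu : seq (R * int)).

(** The real part of the characteristic function, and all of it for an even law, so that the
    analysis stays real. *)
Definition cosine_transform zeta (t : R) := wsum zeta (fun j => cos (j%:~R * t)).

Lemma wsum_odd_eq0 zeta (f : int -> R) :
  (forall g, wsum zeta (fun x => g (- x)) = wsum zeta g) ->
  (forall x, f (- x) = - f x) -> wsum zeta f = 0.
Proof.
move=> ez fN; have := ez f; under eq_wsum do rewrite fN -mulN1r.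
by rewrite wsumZ; lra.
Qed.

Lemma wsumD zeta (f g : int -> R) :
  wsum zeta (fun x => f x + g x) = wsum zeta f + wsum zeta g.
Proof. by rewrite /wsum -big_split; apply: eq_bigr => q _; rewrite mulrDr. Qed.

Lemma cosine_transform_conv mu zeta t :
  (forall g, wsum zeta (fun x => g (- x)) = wsum zeta g) ->
  cosine_transform (wconv mu zeta) t = cosine_transform mu t * cosine_transform zeta t.
Proof.
move=> ez; rewrite /cosine_transform wsum_wconv mulrC -wsumZ.
apply: eq_wsum => x; rewrite mulrC -wsumZ.
have -> : (fun y : int => cos ((x + y)%:~R * t)) = (fun y : int =>
    cos (x%:~R * t) * cos (y%:~R * t) + - sin (x%:~R * t) * sin (y%:~R * t)).
  by apply/funext => y; rewrite intrD mulrDl cosD mulNr.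
rewrite wsumD [X in _ + X]wsumZ (@wsum_odd_eq0 _ (fun y => sin (y%:~R * t))) ?mulr0 ?addr0 //.
by move=> y; rewrite intrN mulNr sinN.
Qed.

Lemma cosine_transform_symms mu k t :
  cosine_transform (symms (nseq k mu)) t = cosine_transform (symm mu) t ^+ k.
Proof.
elim: k => [|k IH]; first by rewrite /cosine_transform wsum_unitm mul0r cos0.
rewrite exprS -IH -cosine_transform_conv // => g; exact: wsum_symms_even.
Qed.

(** This is |E exp(itX)|^2. Its nonnegativity allows upper bounds on the transform to be raised to
    the power k. *)
Lemma cosine_transform_symm mu t :
  cosine_transform (symm mu) t =
  wsum mu (fun x => cos (x%:~R * t)) ^+ 2 + wsum mu (fun x => sin (x%:~R * t)) ^+ 2.
Proof.
rewrite /cosine_transform wsum_symm.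
have -> : (fun x => wsum mu (fun y => cos ((x - y)%:~R * t))) = (fun x =>
    wsum mu (fun y => cos (y%:~R * t)) * cos (x%:~R * t) +
    wsum mu (fun y => sin (y%:~R * t)) * sin (x%:~R * t)).
  apply/funext => x; rewrite [_ * cos _]mulrC [_ * sin _]mulrC -!wsumZ -wsumD; apply: eq_wsum => y.
  by rewrite intrB mulrBl cosB.
by rewrite wsumD !wsumZ !expr2.
Qed.

Lemma cosine_transform_symm_ge0 mu t : 0 <= cosine_transform (symm mu) t.
Proof. by rewrite cosine_transform_symm addr_ge0 ?sqr_ge0. Qed.

Lemma sinMz_pi (j : int) : sin (j%:~R * pi) = 0 :> R.
Proof.
have H n : sin (n%:R * pi) = 0 :> R.
  elim: n => [|n IH]; first by rewrite mul0r sin0.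
  by rewrite -natr1 mulrDl mul1r sinDpi IH oppr0.
by case: j => n; rewrite ?NegzE ?intrN ?mulNr ?sinN -?pmulrn ?H ?oppr0.
Qed.

Let is_deriveMl (f : R -> R) (c t l : R) :
  is_derive t 1 f l -> is_derive t 1 (fun x => c * f x) (c * l).
Proof. by move=> H; apply: is_deriveZ. Qed.

Let primitive zeta (t : R) :=
  wsum zeta (fun j => if j == 0 then t else (j%:~R)^-1 * sin (j%:~R * t)).

Let is_derive_primitive zeta (t : R) :
  is_derive t 1 (primitive zeta) (cosine_transform zeta t).
Proof.
rewrite /primitive /cosine_transform /wsum.
elim: zeta => [|q zeta IH].
  under eq_fun do rewrite big_nil; rewrite big_nil; exact: is_derive_cst.
under eq_fun do rewrite big_cons; rewrite big_cons.
apply: is_deriveD.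
apply: is_deriveMl; case: eqP => [->|/eqP q0].
  by rewrite mul0r cos0; apply: is_derive_id.
have -> : cos (q.2%:~R * t) = (q.2%:~R)^-1 * (q.2%:~R * 1 * cos (q.2%:~R * t)).
  by rewrite mulr1 mulKf // intr_eq0.
apply: is_deriveMl; rewrite mulrC.
apply: (@is_derive1_comp _ sin (fun t => q.2%:~R * t)).
Qed.

Lemma continuous_cosine_transform zeta : continuous (cosine_transform zeta).
Proof.
rewrite /cosine_transform /wsum; elim: zeta => [|q zeta IH].
  by under eq_fun do rewrite big_nil; move=> t; apply: cvg_cst.
under eq_fun do rewrite big_cons.
move=> t; apply: cvgD; last exact: IH.
apply: cvgM; first exact: cvg_cst.
apply: continuous_cvg; first exact: continuous_cos.
by apply: cvgM; [exact: cvg_cst|exact: cvg_id].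
Qed.

(** Fourier inversion at 0: a term with j != 0 integrates to 0 over a full period because sin(j pi)
    = 0. *)
Lemma integral_cosine_transform zeta :
  (\int[lebesgue_measure]_(t in `[(- pi)%R, pi%R]) (cosine_transform zeta t)%:E)%E =
  (2 * pi * mass zeta 0)%:E.
Proof.
have pi0 := pi_gt0 R.
have cP t : {for t, continuous (primitive zeta)}.
  apply: differentiable_continuous; apply/derivable1_diffP.
  by have [] := is_derive_primitive zeta t.
rewrite (@continuous_FTC2 _ _ (primitive zeta)); first last.
- move=> t _; rewrite derive1E; exact: (@derive_val _ _ _ _ _ _ _ (is_derive_primitive zeta t)).
- split.
  + by move=> t _; have [] := is_derive_primitive zeta t.
  + by apply: cvg_at_right_filter; apply: cP.
  + by apply: cvg_at_left_filter; apply: cP.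
- exact/continuous_subspaceT/continuous_cosine_transform.
- lra.
rewrite -EFinB; congr EFin; rewrite /primitive /mass -wsumZ /wsum -sumrB.
apply: eq_bigr => q _; case: eqP => _; first by rewrite /=; ring.
by rewrite mulrN sinN sinMz_pi /=; ring.
Qed.

End cosine_transform.

(** * Laplace's method for powers of the transform *)

Section laplace_bound.
Context (R : realType).

Lemma sin_ge_near0 (d : R) : d < 1 ->
  exists2 t0 : R, 0 < t0 & forall x, `|x| < t0 -> d * `|x| <= `|sin x|.
Proof.
move=> d1; have [H1 H2] := is_derive_sin (0 : R).
have : h^-1 *: ((sin \o shift (0 : R)) (h *: (1 : R)) - sin 0) @[h --> 0^'] --> (1 : R).
  by rewrite -[X in _ --> X](@cos0 R) -H2; apply: H1.
move=> /cvgr_gt/(_ d d1)/nbhs_ballP[t0 /= t00 H].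
exists t0 => // x xt; have [->|x0] := eqVneq x 0; first by rewrite normr0 mulr0.
have := H x; rewrite /ball /= sub0r normrN => /(_ xt x0).
rewrite addr0 sin0 subr0 [_ *: 1]mulr1 /= => dx.
rewrite -ler_pdivlMr ?normr_gt0 // -normfV -normrM mulrC.
by apply: le_trans (ler_norm _); apply: ltW.
Qed.

Lemma cos_half (x : R) : cos x = 1 - 2 * sin (x / 2) ^+ 2.
Proof.
rewrite {1}[x]splitr -mulr2n cos_mulr2n.
by have := cos2Dsin2 (x / 2); rewrite mulr2n; lra.
Qed.

Context (mu : seq (R * int)).
Hypothesis mu_ge0 : nonneg mu.
Hypothesis mu1 : wsum mu (fun=> 1) = 1.
Let psi := cosine_transform (symm mu).
Let V := wsum (symm mu) (fun j => j%:~R ^+ 2) / 2.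
Hypothesis w1_gt0 : 0 < mass (symm mu) 1.

Let symm1 : wsum (symm mu) (fun=> 1) = 1.
Proof.
rewrite wsum_symm -[RHS]mu1; apply: eq_wsum => x; exact: mu1.
Qed.

Let symm_ge0 : nonneg (symm mu). Proof. exact: nonneg_symm. Qed.

Lemma half_variance_gt0 : 0 < V.
Proof.
rewrite divr_gt0 //; apply: lt_le_trans w1_gt0 _; apply: ler_wsum => // j.
by case: eqP => [->|_]; rewrite ?expr1n // sqr_ge0.
Qed.

(** Since 1 - cos(jt) = 2 sin(jt/2)^2 >= d^2 j^2 t^2 / 2 for small t, averaging over j gives 1 - psi
    t >= d^2 V t^2. The choice d^2 = V'/V turns this into V' t^2, and 1 - u <= exp(-u) concludes. *)
Let psi_near0 (V' : R) : 0 < V' < V ->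
  exists2 t0 : R, 0 < t0 & forall t, `|t| < t0 -> psi t <= expR (- (V' * t ^+ 2)).
Proof.
move=> /andP[V0 VV]; have Vp := half_variance_gt0.
pose d := Num.sqrt (V' / V).
have d2 : d ^+ 2 = V' / V by rewrite sqr_sqrtr // divr_ge0 // ltW.
have d0 : 0 <= d by apply: sqrtr_ge0.
have d1 : d < 1 by rewrite -sqrtr1 ltr_sqrt // ltr_pdivrMr // mul1r.
have [t0 t00 Ht] := sin_ge_near0 d1.
(* A bound on the support makes jt/2 small for all atoms j at once. *)
have [M M0 HM] : exists2 M : R, 0 < M &
    forall q, q \in symm mu -> `|q.2%:~R| <= M.
  exists (1 + \sum_(q <- symm mu) `|q.2%:~R|) => [|q qm].
    by rewrite ltr_pwDl // sumr_ge0.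
  rewrite (big_rem q qm) /= addrCA lerDl addr_ge0 // sumr_ge0 //.
exists (t0 / M) => [|t tt]; first by rewrite divr_gt0.
apply: le_trans (expR_ge1Dx _); rewrite /psi /cosine_transform.
have -> : 1 - V' * t ^+ 2 =
    wsum (symm mu) (fun j => 1 + - (d ^+ 2 * t ^+ 2 / 2) * j%:~R ^+ 2).
  rewrite wsumD symm1 wsumZ; congr (_ + _).
  have -> : wsum (symm mu) (fun j => j%:~R ^+ 2) = 2 * V by rewrite /V; field.
  by rewrite d2; field; rewrite gt_eqF.
rewrite /wsum big_seq [leRHS]big_seq; apply: ler_sum => q qm.
apply: ler_wpM2l; first exact: (allP symm_ge0).
rewrite cos_half; set y := q.2%:~R * t / 2.
have yt : `|y| < t0.
  rewrite /y !normrM; have := HM q qm.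
  move: tt; rewrite ltr_pdivlMr //.
  rewrite [`|2^-1|]ger0_norm ?invr_ge0 //.
  have := normr_ge0 t; have := normr_ge0 (q.2%:~R : R); nra.
have := Ht y yt; rewrite -(@ler_sqr _ (d * `|y|)) ?nnegrE ?mulr_ge0 //.
rewrite exprMn !real_normK ?num_real // /y; nra.
Qed.

(** Every cosine is bounded by 1 except the one for j = 1, which decreases on [0, pi]. The positive
    mass at 1 thus acts as an aperiodicity condition, keeping [psi] away from 1 outside a
    neighbourhood of 0. *)
Let psi_far (t0 : R) : 0 < t0 -> t0 <= pi ->
  exists q : R, [/\ 0 <= q, q < 1 &
    forall t, t0 <= `|t| -> `|t| <= pi -> psi t <= q].
Proof.
move=> t00 tpi; pose q := 1 - mass (symm mu) 1 * (1 - cos t0).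
have H t : t0 <= `|t| -> `|t| <= pi -> psi t <= q.
  move=> tt tp; rewrite /psi /cosine_transform.
  have -> : q = wsum (symm mu) (fun j => 1 + - (1 - cos t0) * (j == 1)%:R).
    by rewrite wsumD symm1 wsumZ /q mulNr [in RHS]mulrC.
  apply: ler_wsum => // j; case: eqP => [->|_]; last first.
    by rewrite mulr0 addr0 cos_le1.
  rewrite mul1r mulr1 opprB addrCA subrr addr0 -cos_norm.
  move: tt; rewrite le_eqVlt => /predU1P[->//|tt].
  by rewrite ltW // ltr_cos // in_itv /= ?tp ?normr_ge0 ?(ltW t00) ?tpi.
exists q; split => //.
  by apply: le_trans (H t0 _ _); rewrite ?cosine_transform_symm_ge0 ?gtr0_norm.
rewrite /q ltrBlDr ltrDl mulr_gt0 // subr_gt0 -(@cos0 R).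
by rewrite ltr_cos // in_itv /= ?lexx ?pi_ge0 ?(ltW t00) ?tpi.
Qed.

Let psi_le (V' : R) : 0 < V' < V -> exists q : R, [/\ 0 <= q, q < 1 &
  forall k t, `|t| <= pi -> psi t ^+ k <= expR (- (k%:R * V' * t ^+ 2)) + q ^+ k].
Proof.
move=> V'V; have [t0 t00 H0] := psi_near0 V'V.
have psi0 t : 0 <= psi t by apply: cosine_transform_symm_ge0.
pose t1 := Num.min t0 pi.
have [||q [q0 q1 Hq]] := @psi_far t1.
  by rewrite /t1 lt_min t00 pi_gt0.
  by rewrite /t1 ge_min lexx orbT.
exists q; split => // k t tp; have [tt|tt] := ltP `|t| t1.
  rewrite -[leLHS]addr0 lerD ?exprn_ge0 //.
  rewrite -mulrA -mulrN expRM_natl lerXn2r ?nnegrE ?expR_ge0 //.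
  by apply: H0; apply: lt_le_trans tt _; rewrite /t1 ge_min lexx.
by rewrite -[leLHS]add0r lerD ?expR_ge0 // lerXn2r ?nnegrE // Hq.
Qed.

Lemma integral_expR_sqr (c : R) : 0 < c ->
  (\int[lebesgue_measure]_t (expR (- (c * t ^+ 2)))%:E)%E = (Num.sqrt (pi / c))%:E.
Proof.
(* The integrand is an unnormalized centred normal density of variance 1/(2c). *)
move=> c0; pose s := Num.sqrt (2 * c)^-1.
have s2 : s ^+ 2 = (2 * c)^-1 by rewrite sqr_sqrtr // invr_ge0 mulr_ge0 // ltW.
have s0 : s != 0 by rewrite gt_eqF // sqrtr_gt0 invr_gt0 mulr_gt0.
have := integral_normal_pdf 0 s.
have np : (normal_peak s)^-1 = Num.sqrt (pi / c).
  rewrite invrK; congr Num.sqrt; rewrite s2; field; exact/lt0r_neq0.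
have np0 : normal_peak s != 0 by rewrite gt_eqF // normal_peak_gt0.
under eq_integral => x _ do rewrite /normal_pdf (negbTE s0) EFinM.
rewrite ge0_integralZl //=; first last.
- by rewrite lee_fin normal_peak_ge0.
- by move=> x _; rewrite lee_fin normal_fun_ge0.
- by apply/measurable_EFinP; apply: measurable_normal_fun.
have -> : (\int[lebesgue_measure]_x (normal_fun 0 s x)%:E =
    \int[lebesgue_measure]_x (expR (- (c * x ^+ 2)))%:E)%E.
  apply: eq_integral => x _; congr (_ %:E); rewrite /normal_fun subr0 s2.
  by congr expR; field; exact/lt0r_neq0.
(* Infinite values are excluded, as their product with the positive [normal_peak] could not be 1. *)
case: (\int[_]_x _)%E => [r| |] /=.
- by rewrite -EFinM => -[H]; rewrite -np; congr EFin; rewrite -[r]mul1r -(mulVf np0) -mulrA H mulr1.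
- by rewrite gt0_muley // lte_fin normal_peak_gt0.
- by rewrite gt0_muleNy // lte_fin normal_peak_gt0.
Qed.

(** The Gaussian part is integrated over the whole line, the geometric part over the interval of
    length 2 pi. *)
Lemma mass_symms0_le (V' : R) : 0 < V' < V -> exists q : R, [/\ 0 <= q, q < 1 &
  forall k, (0 < k)%N -> 2 * pi * mass (symms (nseq k mu)) 0 <=
    Num.sqrt (pi / (k%:R * V')) + 2 * pi * q ^+ k].
Proof.
move=> V'V; have [q [q0 q1 Hq]] := psi_le V'V.
have [V0 _] := andP V'V; have pi0 := pi_gt0 R.
exists q; split => // k k0; rewrite -lee_fin -integral_cosine_transform.
under eq_integral do rewrite cosine_transform_symms -/(psi _).
have mE (D : set R) : measurable_fun D (fun t => (expR (- (k%:R * V' * t ^+ 2)))%:E).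
  apply/measurable_EFinP; apply: measurableT_comp => //.
  apply: measurable_funS (@measurableT _ _) (@subsetT _ _) _ => //.
  by apply: measurableT_comp => //; apply: measurable_funM => //; apply: measurable_funX.
apply: le_trans (_ : (\int[lebesgue_measure]_(t in `[(- pi)%R, (pi : R)%R])
    ((expR (- (k%:R * V' * t ^+ 2)))%:E + (q ^+ k)%:E) <= _))%E.
  apply: ge0_le_integral => //=.
  - by move=> t _; rewrite lee_fin exprn_ge0 // cosine_transform_symm_ge0.
  - apply/measurable_EFinP; apply: measurable_funX.
    apply: measurable_funTS; apply: continuous_measurable_fun.
    exact: continuous_cosine_transform.
  - by apply: emeasurable_funD => //; apply: mE.
  - by move=> t; rewrite in_itv /= -ler_norml => tp; rewrite -EFinD lee_fin Hq.
rewrite ge0_integralD //=; [|exact: mE|by move=> t _; rewrite lee_fin exprn_ge0].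
rewrite EFinD; apply: leeD.
  rewrite -integral_expR_sqr; last by rewrite mulr_gt0 // ltr0n.
  apply: ge0_subset_integral => //; exact: mE.
rewrite integral_cst //= lebesgue_measure_itv /= lte_fin.
by rewrite ifT ?gtrN // -EFinB -EFinM lee_fin; nra.
Qed.

End laplace_bound.

(** * The variance of U and of its centred version *)

Section variance_of_U.
Context (R : realType) (a : R).
Hypothesis a01 : 0 < a < 1.

Let m := Num.truncn a^-1.

Lemma U_lawE (A : set nat) :
  U_law a A = (\sum_(l < m.+1) (U_pmf a l)%:E * \d_(l : nat) A)%E.
Proof.
rewrite /U_law a01 esum_mkcond.
have p0 l : (0 <= if l \in A then (U_pmf a l)%:E else 0)%E.
  by case: ifP => // _; rewrite lee_fin U_pmf_ge0.
rewrite (esumID `I_m.+1) // [X in (_ + X)%E]esum1 ?adde0; last first.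
  move=> /= k [_ /negP]; rewrite -leqNgt /U_pmf -/m => ak.
  by rewrite ltnNge ltnW //= gtn_eqF //; case: ifP.
rewrite setTI esum_fset // -fsbig_ord //=; apply: eq_bigr => l _.
by rewrite diracE; case: (_ \in A); rewrite ?mule1 ?mule0.
Qed.

Lemma integral_U_law (f : nat -> R) : (forall l, 0 <= f l) ->
  (\int[U_law a]_l (f l)%:E = (\sum_(l < m.+1) U_pmf a l * f l)%:E)%E.
Proof.
move=> f0; pose c l := NngNum (U_pmf_ge0 l a01).
have mf (g : nat -> \bar R) : measurable_fun setT g by [].
pose mu := msum (fun l => mscale (c l) (\d_l : {measure set nat -> \bar R})) m.+1.
rewrite (@eq_measure_integral _ _ _ setT mu) /mu; last first.
  by move=> A _ _; exact: U_lawE.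
rewrite ge0_integral_measure_sum //=; last by move=> x _; rewrite lee_fin.
rewrite -sumEFin; apply: eq_bigr => l _.
rewrite ge0_integral_mscale //=; last by move=> x _; rewrite lee_fin.
by rewrite integral_dirac //= diracT mul1e.
Qed.

Lemma varUE (e := \sum_(l < m.+1) U_pmf a l * l%:R) :
  varU a = (\sum_(l < m.+1) U_pmf a l * (l%:R - e) ^+ 2)%:E.
Proof.
rewrite /varU /variance unlock.
have -> : ('E_(U_law a)[U_rv R] = e%:E)%E by rewrite unlock integral_U_law.
rewrite unlock -(integral_U_law (fun l => sqr_ge0 (l%:R - e))).
by apply: eq_integral => l _; rewrite expr2.
Qed.

Let sum_nat_shift (n : nat) (c : R) :
  \sum_(i < n) (i%:R - c) = n%:R * (n%:R - 1) / 2 - n%:R * c.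
Proof.
elim: n => [|n IH]; first by rewrite big_ord0; ring.
by rewrite big_ord_recr /= IH -natr1; field.
Qed.

Let sum_sqr_shift (n : nat) (c : R) :
  \sum_(i < n) (i%:R - c) ^+ 2 =
  n%:R * (n%:R - 1) * (2 * n%:R - 1) / 6 - n%:R * (n%:R - 1) * c + n%:R * c ^+ 2.
Proof.
elim: n => [|n IH]; first by rewrite big_ord0; ring.
by rewrite big_ord_recr /= IH -natr1; field.
Qed.

Let sum_U_pmfM (f : nat -> R) : \sum_(l < m.+1) U_pmf a l * f l =
  a * \sum_(l < m) f l + (1 - a * m%:R) * f m.
Proof.
rewrite big_ord_recr /= {2}/U_pmf -/m ltnn eqxx mulr_sumr; congr (_ + _).
by apply: eq_bigr => i _; rewrite /U_pmf -/m ltn_ord.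
Qed.

Lemma varU_closed (M : R := m%:R) :
  varU a = (12^-1 * M * (M + 1) * a * (2 + 4 * M - 3 * a * M - 3 * a * M ^+ 2))%:E.
Proof.
rewrite varUE; congr EFin; set e := \sum_(l < m.+1) U_pmf a l * l%:R.
rewrite (sum_U_pmfM (fun l => (l%:R - e) ^+ 2)) sum_sqr_shift -/M.
have -> : e = a * (M * (M - 1) / 2) + (1 - a * M) * M.
  rewrite /e (sum_U_pmfM (fun l => l%:R)); congr (_ * _ + _).
  have := sum_nat_shift m 0; rewrite mulr0 subr0 => <-.
  by apply: eq_bigr => i _; rewrite subr0.
by field.
Qed.

Lemma half_varianceE :
  (wsum (symm (zigzag_U a)) (fun j => j%:~R ^+ 2) / 2)%:E = varU a.
Proof.
rewrite varU_closed; congr EFin.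
set M : R := m%:R.
have U1 : wsum (zigzag_U a) (fun=> 1) = 1.
  by rewrite wsum_zigzag_U; under eq_bigr do rewrite mulr1; rewrite sum_U_pmf.
pose S1 := wsum (zigzag_U a) (fun j => j%:~R).
pose S2 := wsum (zigzag_U a) (fun j => j%:~R ^+ 2).
have -> : wsum (symm (zigzag_U a)) (fun j => j%:~R ^+ 2) = 2 * (S2 - S1 ^+ 2).
  rewrite wsum_symm.
  have -> : (fun x : int => wsum (zigzag_U a) (fun y => (x - y)%:~R ^+ 2)) =
    (fun x : int => (x%:~R ^+ 2 + - 2 * S1 * x%:~R) + S2 * 1).
    apply/funext => x.
    have -> : (fun y : int => (x - y)%:~R ^+ 2) = (fun y : int =>
        x%:~R ^+ 2 * 1 + (- 2 * x%:~R * y%:~R + y%:~R ^+ 2) : R).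
      by apply/funext => y; rewrite intrB; ring.
    by rewrite !wsumD !wsumZ U1 -/S1 -/S2; ring.
  by rewrite !wsumD !wsumZ U1 -/S1 -/S2; ring.
(* The full atoms lie at i - c for i < m, and d is the place of the last atom, adjacent to them on
   one side or the other; the two cases are the translate and the reflection of U. *)
have [c [d [cd E1 E2]]] : exists c d : R, [/\ d = M - c \/ d = - c - 1,
    S1 = a * (M * (M - 1) / 2 - M * c) + (1 - a * M) * d &
    S2 = a * (M * (M - 1) * (2 * M - 1) / 6 - M * (M - 1) * c + M * c ^+ 2) +
         (1 - a * M) * d ^+ 2].
  exists (m.-1./2)%:R, (zigzag m)%:~R; split.
  - rewrite /zigzag; case: ifP => om; [left|right].
      rewrite -natrB; last by lia.
      by rewrite -pmulrn; congr _%:R; lia.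
    rewrite intrN -pmulrn -opprD natr1; congr (- _%:R).
    by have := truncn_inv_gt0 a01; rewrite -/m; lia.
  - rewrite /S1 wsum_zigzag_U (sum_U_pmfM (fun i => (zigzag i)%:~R)).
    rewrite (@big_zigzag R (fun z => z%:~R)) -sum_nat_shift; congr (_ * _ + _).
    by apply: eq_bigr => i _; rewrite intrB -!pmulrn.
  rewrite /S2 wsum_zigzag_U (sum_U_pmfM (fun i => (zigzag i)%:~R ^+ 2)).
  rewrite (@big_zigzag R (fun z => z%:~R ^+ 2)) -sum_sqr_shift; congr (_ * _ + _).
  by apply: eq_bigr => i _; rewrite intrB -!pmulrn.
rewrite E1 E2; by case: cd => ->; field.
Qed.

(** The points 1 and 0, the second and first terms of [zigzag], both carry weight. When m = 1 the
    weight at 1 is 1 - a, positive because a < 1. *)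
Lemma mass_symm1_gt0 : 0 < mass (symm (zigzag_U a)) 1.
Proof.
have [a0 a1] := andP a01.
have m0 : (0 < m)%N by apply: truncn_inv_gt0.
have U0 i : 0 <= U_pmf a i by apply: U_pmf_ge0.
have ge0 : nonneg (zigzag_U a) by apply: nonneg_zigzag_U.
have u1 : 0 < U_pmf a 1.
  rewrite /U_pmf -/m; case: ltngtP => // m1; first by lia.
  by rewrite -m1 mulr1 subr_gt0.
rewrite /mass wsum_symm wsum_zigzag_U -/m.
have S0 x : 0 <= wsum (zigzag_U a) (fun y => (x - y == 1)%:R) by apply: wsum_ge0.
rewrite (bigD1 (Ordinal (m0 : (1 < m.+1)%N))) //=.
apply: ltr_wpDr; first by apply: sumr_ge0 => i _; rewrite mulr_ge0.
apply: mulr_gt0 => //; rewrite wsum_zigzag_U -/m (bigD1 ord0) //=.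
apply: ltr_wpDr; first by apply: sumr_ge0 => i _; rewrite mulr_ge0 // ler0n.
by rewrite mulr1 /U_pmf -/m m0.
Qed.

End variance_of_U.

Section asymptotics.
Context (R : realType) (a : R).
Hypothesis a01 : 0 < a < 1.

Let V := fine (varU a).

Lemma varU_gt0 : 0 < V.
Proof.
rewrite /V -(half_varianceE a01); apply: half_variance_gt0.
  exact: nonneg_zigzag_U.
exact: mass_symm1_gt0.
Qed.

(** With u = (1 - q)k, q^k <= exp(-u), and exp(u/2) >= 1 + u/2 >= u/2 gives u^2 exp(-u) <= 4. The
    quadratic decay beats the normalizing square root, which is bounded linearly in k. *)
Lemma geometric_le (q : R) (k : nat) : 0 <= q -> q < 1 ->
  q ^+ k * ((1 - q) * k%:R) ^+ 2 <= 4.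
Proof.
move=> q0 q1; set c := 1 - q; have c0 : 0 < c by rewrite subr_gt0.
have qe : q <= expR (- c) by apply: le_trans (expR_ge1Dx _); rewrite /c; lra.
have ck : 0 <= c * k%:R by rewrite mulr_ge0 // ltW.
have e2 : 1 + c * k%:R / 2 <= expR (c * k%:R / 2) by apply: expR_ge1Dx.
have qk : q ^+ k <= (expR (c * k%:R / 2)) ^- 2.
  rewrite -expRM_natl -expRN (_ : - _ = k%:R * (- c)); last by field.
  by rewrite expRM_natl lerXn2r // nnegrE expR_ge0.
apply: le_trans (_ : (expR (c * k%:R / 2)) ^- 2 * (c * k%:R) ^+ 2 <= _).
  by apply: ler_wpM2r => //; apply: sqr_ge0.
rewrite mulrC ler_pdivrMr ?exprn_gt0 ?expR_gt0 //.
have : (1 + c * k%:R / 2) ^+ 2 <= expR (c * k%:R / 2) ^+ 2.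
  rewrite lerXn2r // nnegrE ?expR_ge0 //; lra.
nra.
Qed.

Lemma collision_asymptotics (e : R) : 0 < e -> exists N, forall n, (N <= n)%N ->
  collision a n./2 * Num.sqrt (2 * pi * n%:R * V) <= 1 + e.
Proof.
move=> e0; pose h := e / 2; have h0 : 0 < h by rewrite divr_gt0.
have V0 := varU_gt0; have p0 := pi_gt0 R.
have tp0 : 0 < 2 * pi :> R by rewrite mulr_gt0.
have h1 : 0 < 1 + h by rewrite addr_gt0.
(* With this choice the normalized Gaussian term is sqrt((1 + h) n / (2k)); as n <= 2k + 1 and hk >=
   1, it is at most 1 + h. The other h is kept for the geometric term. *)
pose V' := V / (1 + h).
have V'V : 0 < V' < wsum (symm (zigzag_U a)) (fun j => j%:~R ^+ 2) / 2.
  have -> : wsum (symm (zigzag_U a)) (fun j => j%:~R ^+ 2) / 2 = V.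
    by rewrite /V -(half_varianceE a01).
  by rewrite divr_gt0 ?addr_gt0 //= ltr_pdivrMr ?addr_gt0 // ltr_pMr // ltrDl.
have U1 : wsum (zigzag_U a) (fun=> 1) = 1.
  by rewrite wsum_zigzag_U; under eq_bigr do rewrite mulr1; rewrite sum_U_pmf.
have [V'0 _] := andP V'V.
have [q [q0 q1 Hq]] := mass_symms0_le (nonneg_zigzag_U a01) U1 (mass_symm1_gt0 a01) V'V.
pose c := 1 - q; have c0 : 0 < c by rewrite subr_gt0.
(* The geometric term will be at most C / k, by [geometric_le] and the linear bound [sn] on the
   square root. *)
pose C := 4 * (1 + 6 * pi * V) / c ^+ 2.
have C0 : 0 < C by rewrite divr_gt0 ?exprn_gt0 // mulr_gt0 // addr_gt0 // !mulr_gt0.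
pose K := (Num.truncn (C / h + h^-1)).+1.
exists K.*2 => n Kn.
have Kk : (K <= n./2)%N by rewrite -[K]doubleK half_leq.
have nk : (n <= 2 * n./2 + 1)%N.
  by rewrite mul2n addn1 -[leqLHS]odd_double_half; case: (odd n).
move: Kk nk; set k := n./2 => Kk nk'.
have k0 : (0 < k)%N by apply: leq_trans Kk.
have kR : 0 < k%:R :> R by rewrite ltr0n.
have kK : C / h + h^-1 <= k%:R.
  apply: le_trans (ltW (truncnS_gt _)) _; by rewrite ler_nat.
have Ck : C / k%:R <= h.
  rewrite ler_pdivrMr // mulrC -ler_pdivrMr //; apply: le_trans kK.
  by rewrite lerDl invr_ge0 ltW.
have hk : 1 <= h * k%:R.
  rewrite mulrC -ler_pdivrMr // div1r; apply: le_trans kK.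
  by rewrite lerDr divr_ge0 // ltW.
have nk : n%:R <= 2 * k%:R + 1 :> R.
  by rewrite -natrM natr1 ler_nat -addn1.
have n0 : 0 <= n%:R :> R by exact: ler0n.
set s := Num.sqrt (2 * pi * n%:R * V).
have s0 : 0 <= s by apply: sqrtr_ge0.
have Hc : collision a k <= (2 * pi)^-1 * Num.sqrt (pi / (k%:R * V')) + q ^+ k.
  rewrite -(ler_pM2l tp0) [leRHS]mulrDr mulVKf ?gt_eqF //.
  exact: Hq.
apply: le_trans (ler_wpM2r s0 Hc) _; rewrite [leLHS]mulrDl.
have -> : 1 + e = (1 + h) + h by rewrite /h; field.
apply: lerD.
  rewrite -mulrA -sqrtrM; last by rewrite ltW // divr_gt0 // mulr_gt0.
  rewrite mulrC ler_pdivrMr ?mulr_gt0 //.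
  rewrite -[leRHS]ger0_norm -?sqrtr_sqr; last by rewrite ltW // mulr_gt0.
  apply: ler_wsqrtr.
  have -> : pi / (k%:R * V') * (2 * pi * n%:R * V) =
      2 * pi ^+ 2 * (1 + h) * (n%:R / k%:R).
    rewrite /V'; field; rewrite !gt_eqF ?addr_gt0 //.
  have -> : ((1 + h) * (2 * pi)) ^+ 2 = 2 * pi ^+ 2 * (1 + h) * (2 * (1 + h)) by ring.
  apply: ler_wpM2l; first by rewrite ltW // mulr_gt0 // mulr_gt0 // exprn_gt0.
  rewrite ler_pdivrMr //; clear -nk hk; lra.
have qk := geometric_le k q0 q1.
(* Here n <= 3k; the summand 1 makes the right-hand side at least 1, hence at most its own
   square. *)
have sn : s <= (1 + 6 * pi * V) * k%:R.
  have k1 : 1 <= k%:R :> R by rewrite ler1n.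
  have -> : (1 + 6 * pi * V) * k%:R = Num.sqrt (((1 + 6 * pi * V) * k%:R) ^+ 2).
    by rewrite sqrtr_sqr ger0_norm // mulr_ge0 // addr_ge0 // !mulr_ge0 // ltW.
  apply: ler_wsqrtr.
  have pV : 0 < pi * V by rewrite mulr_gt0.
  have -> : 2 * pi * n%:R * V = 2 * n%:R * (pi * V) by ring.
  have -> : 6 * pi * V = 6 * (pi * V) by ring.
  move: (pi * V) pV => w w0.
  apply: le_trans (_ : 6 * k%:R * w <= _); first by nra.
  apply: le_trans (_ : (1 + 6 * w) * k%:R <= _); first by nra.
  rewrite expr2; apply: ler_peMr; first by rewrite mulr_ge0 //; lra.
  rewrite mulrC -[1]mulr1; apply: ler_pM => //; lra.
apply: le_trans (ler_wpM2l (exprn_ge0 k q0) sn) _; apply: le_trans Ck.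
have c2 : 0 < c ^+ 2 by rewrite exprn_gt0.
have Cc : C * c ^+ 2 = 4 * (1 + 6 * pi * V) by rewrite mulfVK // gt_eqF.
rewrite ler_pdivlMr // -(ler_pM2r c2) Cc.
have -> : q ^+ k * ((1 + 6 * pi * V) * k%:R) * k%:R * c ^+ 2 =
  (q ^+ k * (c * k%:R) ^+ 2) * (1 + 6 * pi * V) by ring.
by apply: ler_wpM2r => //; rewrite addr_ge0 // !mulr_ge0 // ltW.
Qed.

(** The o(1) of the statement. Cutting off at 0 lets the one-sided estimate of
    [collision_asymptotics] yield convergence. *)
Definition excess (n : nat) : R :=
  Num.max 0 (collision a n./2 * Num.sqrt (2 * pi * n%:R * V) - 1).

Lemma cvg_excess : excess n @[n --> \oo] --> 0.
Proof.
apply/cvgrPdist_le => e e0; have [N HN] := collision_asymptotics e0.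
exists N => // n /= Nn; rewrite sub0r normrN ger0_norm ?le_max ?lexx //.
by rewrite ge_max ltW //= lerBlDl HN.
Qed.

Lemma collision_le_excess (n : nat) : (0 < n)%N ->
  collision a n./2 <= (2 * pi * n%:R * V) `^ (- 2^-1) * (1 + excess n).
Proof.
move=> n0; set x := 2 * pi * n%:R * V.
have x0 : 0 < x by rewrite !mulr_gt0 ?pi_gt0 ?ltr0n ?varU_gt0.
rewrite powRN powR12_sqrt ?(ltW x0) // [leRHS]mulrC ler_pdivlMr ?sqrtr_gt0 //.
by rewrite -lerBlDl /excess le_max lexx orbT.
Qed.

End asymptotics.

(** * Reduction to finitely many atoms *)

Section independence.
Context (R : realType) (dT : measure_display) (T : measurableType dT)
  (P : probability T R).

Section fubini_sub_sigma_algebra.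
Context (dV : measure_display) (V : measurableType dV) (X : {RV P >-> V}).
Context (G : set (set T)).
Hypothesis G_measurable : G `<=` measurable.
Hypothesis G_setI : setI_closed G.
Hypothesis GT : G setT.
Hypothesis G_indep : forall E B, G E -> measurable B ->
  (P (E `&` X @^-1` B) = P E * P (X @^-1` B))%E.

Let T1 : measurableType G.-sigma := g_sigma_algebraType G.

Let sG_measurable (E : set T) : (measurable : set (set T1)) E -> measurable E.
Proof. exact: (smallest_sub (@sigma_algebra_measurable _ T) G_measurable). Qed.

Let sG_indep (E : set T) (B : set V) : (measurable : set (set T1)) E -> measurable B ->
  (P (E `&` X @^-1` B) = P E * P (X @^-1` B))%E.
Proof.
move=> mE mB.
have mXB : measurable (X @^-1` B) by rewrite -[_ @^-1` _]setTI; exact: measurable_funP.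
have fXB : P (X @^-1` B) \is a fin_num by exact: fin_num_measure.
pose c := NngNum (fine_ge0 (measure_ge0 P (X @^-1` B))).
have cE : (c%:num%:E = P (X @^-1` B))%E by rewrite /= fineK.
(* Both sides are finite measures in [E] that agree on the pi-system [G], hence on the sigma-algebra
   it generates. *)
have := @g_sigma_algebra_measure_unique _ _ _ G G_measurable (fun=> setT) (fun=> GT)
  _ (mrestr P mXB) (mscale c P) G_setI.
rewrite /mrestr /= /mscale cE => H; rewrite [RHS]muleC; apply: H => //.
- by rewrite bigcup_const.
- move=> A GA; rewrite [RHS]muleC; exact: G_indep.
- move=> _; apply: (le_lt_trans (probability_le1 P _)); last exact: ltry.
  exact: measurableI.
Qed.

Let id1 : T -> T1 := id.

Let measurable_id1 : measurable_fun setT id1.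
Proof. by move=> _ E /sG_measurable; rewrite setTI. Qed.

(** The identity of T, taken into T with the smaller sigma-algebra, is independent of X, so the pair
    has a product law and P(D) is an integral over sections. With T itself as first factor, no
    vector of the other variables has to be formed. *)
Lemma indep_section_le (D : set (T1 * V)) (e : \bar R) : measurable D ->
  (forall w, P (X @^-1` [set v | D (w, v)]) <= e)%E ->
  (P [set w | D (w, X w)] <= e)%E.
Proof.
move=> mD De.
pose id_rv : {mfun T >-> T1} :=
  HB.pack id1 (isMeasurableFun.Build _ _ _ _ id1 measurable_id1).
have mpair : measurable_fun setT (fun w : T => (id1 w, X w) : T1 * V).
  exact: measurable_fun_pair.
pose pair_rv : {mfun T >-> (T1 * V)%type} :=
  HB.pack (fun w : T => (id1 w, X w) : T1 * V)
    (isMeasurableFun.Build _ _ _ _ (fun w : T => (id1 w, X w) : T1 * V) mpair).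
rewrite -[P _]/(distribution P pair_rv D).
have := @product_measure_unique _ _ T1 V R (distribution P id_rv) (distribution P X)
  (distribution P pair_rv).
move=> /(_ _ D mD) <-; last first.
  by move=> A B mA mB; apply: sG_indep.
apply: le_trans (_ : (\int[distribution P id_rv]_w e <= e)%E).
  apply: ge0_le_integral => //.
    apply: measurable_fun_xsection => //.
  move=> w _ /=; apply: le_trans (De w); rewrite /distribution /pushforward.
  rewrite (_ : xsection D w = [set v | D (w, v)]) //.
  by apply/seteqP; split => v; rewrite /xsection /= inE.
rewrite integral_cst //= probability_setT mule1 //.
Qed.

End fubini_sub_sigma_algebra.
End independence.

Section borel_row_vectors.
Context (R : realType) (d : nat).

Lemma measurable_coord (c : 'I_d) :
  measurable_fun setT (fun v : 'rV[R]_d => v ord0 c).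
Proof.
apply: (measurability _ (RGenOpens.measurableE R)) => _ [_ [a [b ->] <-]].
rewrite setTI; apply: sub_sigma_algebra.
move: (@coord_continuous R 1 d ord0 c) => /continuousP; apply.
exact: interval_open.
Qed.

(** Measurability is asked of the coordinates only, so sums of random vectors reduce to sums of real
    functions. *)
Lemma measurable_fun_rV_eq (dT : measure_display) (T : measurableType dT)
    (f : T -> 'rV[R]_d) (x : 'rV[R]_d) :
  (forall c, measurable_fun setT (fun w => f w ord0 c)) ->
  measurable [set w | f w = x].
Proof.
move=> mf.
have -> : [set w | f w = x] =
    \bigcap_(c in [set: 'I_d]) ((fun w => f w ord0 c) @^-1` [set x ord0 c]).
  apply/seteqP; split => [w fw c _|w H]; first by rewrite /= fw.
  by apply/rowP => c; apply: H.
apply: fin_bigcap_measurable => // c _.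
rewrite -[_ @^-1` _]setTI; apply: mf => //.
Qed.

Lemma measurable_set1_rV (x : 'rV[R]_d) : measurable [set x].
Proof.
rewrite (_ : [set x] = [set w : 'rV[R]_d | w = x]) //.
by apply: (measurable_fun_rV_eq (f := id)) => c; exact: measurable_coord.
Qed.

Lemma measurable_set_seq_rV (F : seq 'rV[R]_d) : measurable [set` F].
Proof.
rewrite (_ : [set` F] = \bigcup_(y in [set` F]) [set y]).
  by rewrite bigcup_seq; apply: bigsetU_measurable => y _; exact: measurable_set1_rV.
by apply/seteqP; split => [y yF|y [z zF ->]] //; exists y.
Qed.

End borel_row_vectors.

Section sum_of_independent.
Context (R : realType) (n d : nat) (dT : measure_display) (T : measurableType dT)
  (P : probability T R) (X : 'I_n -> {RV P >-> 'rV[R]_d}).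
Hypothesis indepX : mutually_independent X.

Let measurable_preimage (i : 'I_n) (A : set 'rV[R]_d) :
  measurable A -> measurable (X i @^-1` A).
Proof. by move=> mA; rewrite -[_ @^-1` _]setTI; exact: measurable_funP. Qed.

(* Fubini on the product of the sigma-algebra generated by the X j, j != i, and
   of the space of values of X i. *)
Lemma sum_eq_outside_le (i : 'I_n) (F : set 'rV[R]_d) (e : \bar R)
    (x : 'rV[R]_d) :
  measurable F -> (0 <= e)%E -> (forall y, ~ F y -> (P (X i @^-1` [set y]) <= e)%E) ->
  (P [set w | ~ F (X i w) /\ (\sum_(j < n) X j w)%R = x] <= e)%E.
Proof.
move=> mF e0 Fe.
(* The pi-system of the rectangles in the X j with j != i, coordinate i being left free. *)
pose G : set (set T) := [set E | exists A : 'I_n -> set 'rV[R]_d,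
  [/\ forall j, measurable (A j), A i = setT &
      E = \bigcap_(j in [set: 'I_n]) (X j @^-1` A j)]].
have Gm : G `<=` measurable.
  move=> _ [A [mA _ ->]]; apply: fin_bigcap_measurable => // j _.
  exact: measurable_preimage.
have GI : setI_closed G.
  move=> _ _ [A [mA Ai ->]] [B [mB Bi ->]].
  exists (fun j => A j `&` B j); split; first by move=> j; apply: measurableI.
    by rewrite Ai Bi setTI.
  by rewrite -bigcapI.
have GT : G setT.
  exists (fun=> setT); split => //; apply/esym; rewrite -subTset => w _ j _ //.
have Gind (E : set T) (B : set 'rV[R]_d) : G E -> measurable B ->
    (P (E `&` X i @^-1` B) = P E * P (X i @^-1` B))%E.
  move=> [A [mA Ai ->]] mB; rewrite indepX //.
  pose A' j := if j == i then B else A j.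
  have mA' j : measurable (A' j) by rewrite /A'; case: ifP.
  have -> : \bigcap_(j in [set: 'I_n]) (X j @^-1` A j) `&` X i @^-1` B =
      \bigcap_(j in [set: 'I_n]) (X j @^-1` A' j).
    apply/seteqP; split => w.
      by move=> [Aw Bw] j _; rewrite /A'; case: eqP => [->//|_]; apply: Aw.
    move=> Aw; split; last by have := Aw i Logic.I; rewrite /A' eqxx.
    move=> j _; have := Aw j Logic.I; rewrite /A'; case: eqP => // -> _.
    by rewrite Ai.
  rewrite indepX // (bigD1 i) //= [in RHS](bigD1 i) //= Ai preimage_setT probability_setT.
  rewrite mul1e /A' eqxx muleC; congr (_ * _)%E.
  by apply: eq_bigr => j /negbTE->.
have Xj j : j != i -> measurable_fun setT (X j : g_sigma_algebraType G -> 'rV[R]_d).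
  move=> ji _ B mB; rewrite setTI; apply: sub_sigma_algebra.
  exists (fun k => if k == j then B else setT); split.
  - by move=> k; case: ifP.
  - by rewrite eq_sym (negbTE ji).
  - apply/seteqP; split => w; first by move=> Bw k _; case: eqP => // ->.
    by move=> /(_ j Logic.I); rewrite eqxx.
pose D : set (g_sigma_algebraType G * 'rV[R]_d) :=
  [set p | ~ F p.2 /\ \sum_(j < n | j != i) X j p.1 + p.2 = x].
have mD : measurable D.
  have -> : D = (snd @^-1` ~` F) `&`
    [set p : g_sigma_algebraType G * 'rV[R]_d |
      \sum_(j < n | j != i) X j p.1 + p.2 = x] by [].
  apply: measurableI.
    rewrite -[_ @^-1` _]setTI; apply: measurable_snd => //.
    exact: measurableC.
  apply: measurable_fun_rV_eq => c.
  have -> : (fun w : g_sigma_algebraType G * 'rV[R]_d =>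
      (\sum_(j < n | j != i) X j w.1 + w.2) ord0 c) =
    (fun w => \sum_(j < n) (if j != i then X j w.1 ord0 c else 0) + w.2 ord0 c).
    by apply/funext => w; rewrite mxE summxE big_mkcond.
  apply: measurable_funD.
    apply: measurable_sum => j; case: (boolP (j != i)) => // ji.
    apply: (measurableT_comp (@measurable_coord R d c)).
    by apply: (measurableT_comp (Xj j ji)); exact: measurable_fst.
  by apply: (measurableT_comp (@measurable_coord R d c)); exact: measurable_snd.
have -> : [set w | ~ F (X i w) /\ \sum_(j < n) X j w = x] = [set w | D (w, X i w)].
  have E w : \sum_(j < n) X j w = \sum_(j < n | j != i) X j w + X i w.
    by rewrite (bigD1 i) //= addrC.
  by apply/seteqP; split => w; rewrite /D /= E.
apply: (indep_section_le Gm GI GT Gind mD) => w.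
(* The section at w contains at most this point, and is empty when the point lies in [F]. *)
pose y := x - \sum_(j < n | j != i) X j w.
have sub (v : 'rV[R]_d) : D (w, v) -> v = y /\ ~ F v.
  by move=> [/= Fv wv]; split => //; rewrite /y -wv addrC addKr.
have [Fy|Fy] := pselect (F y).
  rewrite (_ : X i @^-1` _ = set0) ?measure0 //.
  by apply/seteqP; split => // t /= /sub[->].
apply: le_trans (Fe y Fy); apply: le_measure; rewrite ?inE.
- apply: measurable_preimage.
  rewrite (_ : [set v | D (w, v)] = xsection D w); first exact: measurable_xsection.
  by apply/seteqP; split => v; rewrite /xsection /= inE.
- by apply: measurable_preimage; exact: measurable_set1_rV.
- by move=> t /= /sub[].
Qed.

End sum_of_independent.

(** The functional reads a vector as the coefficients of a polynomial and evaluates it at t. The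
    nonzero differences of points of [F] give a nonzero product of polynomials, and t is chosen off
    its roots. *)
Lemma exists_injective_functional (R : realType) (d : nat) (F : seq 'rV[R]_d) :
  exists phi : 'rV[R]_d -> R,
    (forall u v, phi (u - v) = phi u - phi v) /\ {in F &, injective phi}.
Proof.
pose D := [seq q <- [seq (p.1 - p.2) | p <- allpairs pair F F] | q != 0].
pose p := \prod_(u <- D) rVpoly u.
have p0 : p != 0.
  rewrite prodf_seq_neq0; apply/allP => u; rewrite mem_filter => /andP[u0 _] /=.
  apply: contra u0 => /eqP u0; rewrite -[u]rVpolyK u0; apply/eqP; exact: raddf0.
have [t pt] : exists t : R, p.[t] != 0.
  apply: contrapT => /forallNP H.
  (* The [size p] candidates are one more than the degree of [p], so they cannot all be roots. *)
  have := @max_poly_roots _ p [seq i%:R | i <- iota 0 (size p)] p0.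
  rewrite size_map size_iota ltnn => H'; suff: false by []; apply: H'.
    by apply/allP => t _; apply/rootP; apply: contrapT => /eqP /(H t).
  rewrite map_inj_uniq ?iota_uniq // => i j /eqP; rewrite eqr_nat => /eqP //.
exists (fun v => (rVpoly v).[t]); split => [u v|u v uF vF uv].
  by rewrite raddfB /= hornerD hornerN.
apply: contrapT => /eqP; rewrite -subr_eq0 => uv0.
have uvD : u - v \in D.
  rewrite mem_filter uv0; apply/mapP; exists (u, v) => //.
  by apply/allpairsP; exists (u, v).
move: pt; rewrite /p (big_rem _ uvD) /= hornerM raddfB /= hornerD hornerN uv.
by rewrite subrr mul0r eqxx.
Qed.

Section finitely_many_large_atoms.
Context (R : realType) (d : nat) (dT : measure_display) (T : measurableType dT)
  (P : probability T R).

Lemma measurable_preimage_set1 (X : {RV P >-> 'rV[R]_d}) y :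
  measurable (X @^-1` [set y]).
Proof.
by rewrite -[_ @^-1` _]setTI; apply: measurable_funP => //; exact: measurable_set1_rV.
Qed.

Lemma fine_preimage_set1 (X : {RV P >-> 'rV[R]_d}) y :
  ((fine (P (X @^-1` [set y])))%:E = P (X @^-1` [set y]))%E.
Proof. by rewrite fineK // fin_num_measure //; exact: measurable_preimage_set1. Qed.

Let preimage_set_cons (X : {RV P >-> 'rV[R]_d}) y (F : seq 'rV[R]_d) :
  X @^-1` [set` y :: F] = X @^-1` [set y] `|` X @^-1` [set` F].
Proof.
apply/seteqP; split => w /=; rewrite inE.
  by move=> /predU1P[->|?]; [left|right].
by move=> [->|->]; rewrite ?eqxx ?orbT.
Qed.

Lemma measurable_preimage_seq (X : {RV P >-> 'rV[R]_d}) (F : seq 'rV[R]_d) :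
  measurable (X @^-1` [set` F]).
Proof.
rewrite -[_ @^-1` _]setTI; apply: measurable_funP => //.
exact: measurable_set_seq_rV.
Qed.

Lemma sum_atoms_le1 (X : {RV P >-> 'rV[R]_d}) (F : seq 'rV[R]_d) : uniq F ->
  \sum_(y <- F) fine (P (X @^-1` [set y])) <= 1.
Proof.
move=> uF; rewrite -lee_fin -sumEFin.
under eq_bigr do rewrite fine_preimage_set1.
suff -> : (\sum_(y <- F) P (X @^-1` [set y]) = P (X @^-1` [set` F]))%E.
  exact: probability_le1 (measurable_preimage_seq X F).
elim: F uF => [_|y F IH /= /andP[yF uF]].
  by rewrite big_nil (_ : _ @^-1` _ = set0) ?measure0 //; apply/seteqP; split.
rewrite big_cons IH // preimage_set_cons measureU //.
- exact: measurable_preimage_set1.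
- exact: measurable_preimage_seq.
- by apply/seteqP; split => // w /= [-> yF']; rewrite yF' in yF.
Qed.

Lemma finite_large_atoms (X : {RV P >-> 'rV[R]_d}) (e : R) : 0 < e ->
  exists F : seq 'rV[R]_d, forall y, y \notin F -> fine (P (X @^-1` [set y])) <= e.
Proof.
move=> e0; apply: contrapT => /forallNP H.
have big k : exists F : seq 'rV[R]_d, [/\ uniq F, size F = k &
    forall y, y \in F -> e <= fine (P (X @^-1` [set y]))].
  elim: k => [|k [F [uF sF eF]]]; first by exists [::].
  have /existsNP[y /not_implyP[yF /negP]] := H F.
  rewrite -ltNge => ey; exists (y :: F); split => /=; [by rewrite yF|by rewrite sF|].
  by move=> z; rewrite inE => /predU1P[->|/eF //]; exact: ltW.
have [F [uF sF eF]] := big (Num.truncn e^-1).+1.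
have := sum_atoms_le1 X uF; apply/negP; rewrite -ltNge.
apply: lt_le_trans (_ : \sum_(y <- F) e <= _); last first.
  by rewrite big_seq [leRHS]big_seq; apply: ler_sum => y; exact: eF.
rewrite big_const_seq count_predT iter_addr_0 sF -mulr_natl -ltr_pdivrMr // div1r.
exact: truncnS_gt.
Qed.

End finitely_many_large_atoms.

Section sum_of_atoms.
Context (R : realType) (n d : nat) (dT : measure_display) (T : measurableType dT)
  (P : probability T R) (X : 'I_n -> {RV P >-> 'rV[R]_d}).
Hypothesis indepX : mutually_independent X.

Lemma Boole_inequality_seq (I : eqType) (F : seq I) (B : I -> set T) :
  (forall y, measurable (B y)) ->
  (P (\big[setU/set0]_(y <- F) B y) <= \sum_(y <- F) P (B y))%E.
Proof.
move=> mB; elim: F => [|y F IH]; first by rewrite !big_nil measure0.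
rewrite !big_cons; apply: le_trans (measureU2 _ _ _) _ => //.
  by apply: bigsetU_measurable.
exact: leeD2l.
Qed.

Context (F : seq 'rV[R]_d) (phi : 'rV[R]_d -> R).
Hypothesis uF : uniq F.
Hypothesis phiB : forall u v, phi (u - v) = phi u - phi v.

Definition atoms_law (i : 'I_n) : seq (R * R) :=
  [seq (fine (P (X i @^-1` [set y])), phi y) | y <- F].

Let event (s : seq 'I_n) (x : 'rV[R]_d) (A : 'I_n -> set 'rV[R]_d) : set T :=
  [set w | [/\ forall i, i \in s -> X i w \in F, \sum_(i <- s) X i w = x &
               forall j, j \notin s -> A j (X j w)]].

Let measurable_preimage (i : 'I_n) (A : set 'rV[R]_d) :
  measurable A -> measurable (X i @^-1` A).
Proof. by move=> mA; rewrite -[_ @^-1` _]setTI; exact: measurable_funP. Qed.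

Let measurable_sum_eq (s : seq 'I_n) x : measurable [set w | \sum_(i <- s) X i w = x].
Proof.
apply: measurable_fun_rV_eq => c; under eq_fun do rewrite summxE.
apply: measurable_sum => j.
by apply: (measurableT_comp (@measurable_coord R d c)).
Qed.

Let measurable_event s x A : (forall j, measurable (A j)) ->
  measurable (event s x A).
Proof.
move=> mA.
have -> : event s x A = \bigcap_(i in [set: 'I_n]) (X i @^-1` (if i \in s then [set` F] else A i))
    `&` [set w | \sum_(i <- s) X i w = x].
  apply/seteqP; split => w /=.
    move=> [H1 H2 H3]; split => // i _ /=.
    by case: (boolP (i \in s)) => [/H1|/H3].
  move=> [H1 H2]; split => // [i is_|j js].
    by have := H1 i Logic.I; rewrite is_.
  by have := H1 j Logic.I; rewrite (negbTE js).
apply: measurableI => //; apply: fin_bigcap_measurable => // i _.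
case: ifP => _; first exact: measurable_preimage_seq.
exact: measurable_preimage.
Qed.

(** Each step splits over the value y of one X i and records it in the family [A], which peels off
    one convolution factor. Independence is then invoked just once, for the empty [s], where the
    event lies in a rectangle. *)
Let event_le s x A : uniq s -> (forall j, measurable (A j)) ->
  (P (event s x A) <= (mass (convs (map atoms_law s)) (phi x) *
    \prod_(j | j \notin s) fine (P (X j @^-1` A j)))%:E)%E.
Proof.
elim: s x A => [|i s IH] x A us mA.
  have [->|x0] := eqVneq x 0.
    rewrite /mass wsum_unitm -[in phi 0](subrr 0) phiB subrr eqxx mul1r.
    have -> : ((\prod_(j | j \notin [::]) fine (P (X j @^-1` A j)))%:E =
        P (\bigcap_(j in [set: 'I_n]) (X j @^-1` A j)))%E.
      rewrite indepX // (big_morph EFin (@EFinM R) erefl); apply: eq_bigr => j _.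
      by rewrite fineK // fin_num_measure //; exact: measurable_preimage.
    apply: le_measure; rewrite ?inE.
    - exact: measurable_event.
    - by apply: fin_bigcap_measurable => // j _; exact: measurable_preimage.
    - by move=> w [_ _ H] j _; apply: H.
  rewrite (_ : event _ _ _ = set0) ?measure0.
    rewrite lee_fin mulr_ge0 //; first by apply: mass_ge0; exact: nonneg_unitm.
    by apply: prodr_ge0 => j _; apply: fine_ge0.
  apply/seteqP; split => // w [_ + _]; rewrite big_nil => /esym/eqP.
  by rewrite (negbTE x0).
move: us => /= /andP[is_ us].
pose Ay y j := if j == i then [set y] else A j.
have mAy y j : measurable (Ay y j).
  by rewrite /Ay; case: ifP => // _; exact: measurable_set1_rV.
have mev y : measurable (event s (x - y) (Ay y)) by apply: measurable_event.
apply: (@le_trans _ _ (\sum_(y <- F) P (event s (x - y) (Ay y)))%E).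
  apply: le_trans (Boole_inequality_seq F mev); apply: le_measure; rewrite ?inE.
  - exact: measurable_event.
  - exact: bigsetU_measurable.
  - rewrite -bigcup_seq => w [H1 H2 H3]; exists (X i w).
      by apply: H1; rewrite mem_head.
    split => [j js||j js].
    + by apply: H1; rewrite inE js orbT.
    + by rewrite -H2 big_cons addrC addKr.
    + rewrite /Ay; case: eqP => [->//|/eqP ji].
      by apply: H3; rewrite inE negb_or ji.
rewrite /mass /= wsum_wconv {1}/wsum big_map /= mulr_suml -sumEFin.
apply: lee_sum => y _; apply: le_trans (IH _ _ us (mAy y)) _.
rewrite lee_fin le_eqVlt; apply/orP; left; apply/eqP.
rewrite (bigD1 i) //= /Ay eqxx mulrCA mulrA; congr (_ * _ * _).
  rewrite phiB; apply: eq_wsum => z; congr (nat_of_bool _)%:R.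
  by apply/eqP/eqP => [->|<-]; ring.
apply: eq_big => [j|j /andP[_ /negbTE->]] //.
by rewrite inE negb_or andbC.
Qed.

Lemma sum_in_atoms_le x :
  (P [set w | (forall i, X i w \in F) /\ (\sum_(i < n) X i w)%R = x] <=
   (mass (convs (map atoms_law (enum 'I_n))) (phi x))%:E)%E.
Proof.
have := @event_le (enum 'I_n) x (fun=> setT) (enum_uniq _) (fun=> measurableT).
rewrite big_pred0 => [|j]; last by rewrite mem_enum.
rewrite mulr1; apply: le_trans; apply: le_measure; rewrite ?inE.
- rewrite (_ : mkset _ = event (enum 'I_n) x (fun=> setT)); first exact: measurable_event.
  apply/seteqP; split => w /=.
    by move=> [H1 H2]; split => //; rewrite big_enum.
  by move=> [H1 H2 _]; split; [move=> i; apply: H1; rewrite mem_enum|rewrite -H2 big_enum].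
- exact: measurable_event.
- by move=> w [H1 H2]; split => //; rewrite big_enum.
Qed.

Hypothesis phi_inj : {in F &, injective phi}.

Lemma wsum_atoms_law_le1 i : wsum (atoms_law i) (fun=> 1) <= 1.
Proof.
rewrite /wsum big_map /=; under eq_bigr do rewrite mulr1.
exact: sum_atoms_le1.
Qed.

(** Injectivity of [phi] on [F] keeps atoms from merging: at most one point of [F] lies over z. *)
Lemma mass_atoms_law_le (a : R) i (z : R) : 0 <= a ->
  (forall y, (P (X i @^-1` [set y]) <= a%:E)%E) -> mass (atoms_law i) z <= a.
Proof.
move=> a0 Pa; rewrite /mass /wsum big_map /=.
have [/hasP[y yF /eqP yz]|/hasPn H] := boolP (has (fun y => phi y == z) F).
  rewrite (bigD1_seq y) //= yz eqxx mulr1 big1_seq ?addr0.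
    by rewrite -lee_fin fine_preimage_set1.
  move=> y' /andP[y'y y'F]; case: eqP => [y'z|]; last by rewrite mulr0.
  by rewrite (phi_inj y'F yF) ?eqxx ?y'z // in y'y.
by rewrite big1_seq // => y /andP[_ /H/negbTE->]; rewrite mulr0.
Qed.

End sum_of_atoms.

Theorem sum_eq_le_collision (R : realType) (a : R) (n d : nat)
    (dT : measure_display) (T : measurableType dT) (P : probability T R)
    (X : 'I_n -> {RV P >-> 'rV[R]_d}) (x : 'rV[R]_d) :
  0 < a < 1 -> mutually_independent X ->
  (forall i y, (P (X i @^-1` [set y]) <= a%:E)%E) ->
  (P [set w | (\sum_(i < n) X i w)%R = x] <= (collision a n./2)%:E)%E.
Proof.
move=> a01 indepX Xa; have [a0 _] := andP a01.
(* There are n events where some X i misses [F], each of probability at most e', and n e' <= e. *)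
apply/lee_addgt0Pr => e e0; pose e' := e / n.+1%:R.
have e'0 : 0 < e' by rewrite divr_gt0.
have [f Hf] := choice (fun i => finite_large_atoms (X i) e'0).
pose F := undup (flatten [seq f i | i <- enum 'I_n]).
have uF : uniq F by apply: undup_uniq.
have HF i y : y \notin F -> fine (P (X i @^-1` [set y])) <= e'.
  move=> yF; apply: Hf; apply: contra yF => yf; rewrite mem_undup.
  by apply/flattenP; exists (f i) => //; apply: map_f; rewrite mem_enum.
have [phi [phiB phi_inj]] := exists_injective_functional F.
pose out (i : 'I_n) := [set w | ~ [set` F] (X i w) /\ (\sum_(i < n) X i w)%R = x].
pose inn := [set w | (forall i, X i w \in F) /\ (\sum_(i < n) X i w)%R = x].
have mS : measurable [set w | (\sum_(i < n) X i w)%R = x].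
  apply: measurable_fun_rV_eq => c; under eq_fun do rewrite summxE.
  apply: measurable_sum => j.
  by apply: (measurableT_comp (@measurable_coord R d c)).
have mF i : measurable (X i @^-1` [set` F]) by exact: measurable_preimage_seq.
have mout i : measurable (out i).
  rewrite (_ : out i = ~` (X i @^-1` [set` F]) `&` [set w | (\sum_(i < n) X i w)%R = x]) //.
  by apply: measurableI => //; exact: measurableC.
have minn : measurable inn.
  rewrite (_ : inn = \bigcap_(i in [set: 'I_n]) (X i @^-1` [set` F]) `&`
    [set w | (\sum_(i < n) X i w)%R = x]).
    by apply: measurableI => //; apply: fin_bigcap_measurable.
  by apply/seteqP; split => w /= [H1 H2]; split => // i; [move=> _; exact: H1|exact: H1].
apply: (@le_trans _ _ (P inn + \sum_(i <- enum 'I_n) P (out i))%E).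
  apply: (@le_trans _ _ (P inn + P (\big[setU/set0]_(i <- enum 'I_n) out i))%E).
    2: by apply: leeD2l; apply: Boole_inequality_seq.
  have mU : measurable (\big[setU/set0]_(i <- enum 'I_n) out i).
    exact: bigsetU_measurable.
  apply: le_trans (measureU2 P minn mU); apply: le_measure; rewrite ?inE //.
    exact: measurableU.
  move=> w Sw; have [H|/existsNP[i Hi]] := pselect (forall i, X i w \in F).
    by left.
  by right; rewrite -bigcup_seq; exists i => //=; rewrite mem_enum.
apply: leeD.
  apply: le_trans (sum_in_atoms_le indepX _ phiB x) _.
  have sn : size (map (atoms_law X F phi) (enum 'I_n)) = n.
    by rewrite size_map size_enum_ord.
  rewrite lee_fin -[in leRHS]sn; apply: mass_convs_le_collision => // _ /mapP[i _ ->].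
  split; [| exact: wsum_atoms_law_le1 |].
    by apply/allP => _ /mapP[y _ ->] /=; apply: fine_ge0.
  by move=> z; apply: mass_atoms_law_le => //; exact: ltW.
apply: (@le_trans _ _ (\sum_(i <- enum 'I_n) e'%:E)%E).
  apply: lee_sum => i _; apply: sum_eq_outside_le => //.
  - exact: measurable_set_seq_rV.
  - by rewrite lee_fin ltW.
  - by move=> y /negP yF; rewrite -fine_preimage_set1 lee_fin HF.
rewrite sumEFin lee_fin big_enum sumr_const card_ord -mulr_natr /e'.
rewrite -mulrA ger_pMr // mulrC ler_pdivrMr // mul1r ler_nat; exact: leqnSn.
Qed.

Theorem corollary2 (R : realType) (a : R) (a01 : 0 < a < 1) :
  let m : R := (Num.truncn a^-1)%:R in
  varU a = (12^-1 * m * (m + 1) * a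
            * (2 + 4 * m - 3 * a * m - 3 * a * m ^+ 2))%:E
  /\
  exists eps : nat -> R,
    (eps n @[n --> \oo] --> 0) /\
    forall (n d : nat) (disp : measure_display) (T : measurableType disp)
        (P : probability T R) (X : 'I_n -> {RV P >-> 'rV[R]_d}),
      (0 < n)%N ->
      mutually_independent X ->
      (forall i : 'I_n,
        (ereal_sup [set P [set w | X i w = y] | y in [set: 'rV[R]_d]]
          <= a%:E)%E) ->
      forall x : 'rV[R]_d,
        (P [set w | (\sum_(i < n) X i w)%R = x]
          <= ((2 * pi * n%:R * fine (varU a)) `^ (- 2^-1)
              * (1 + eps n))%:E)%E.
Proof.
move=> m; split; first exact: varU_closed.
exists (excess a); split; first exact: cvg_excess.
move=> n d disp T P X n0 indepX Xa x.
apply: (@le_trans _ _ (collision a n./2)%:E).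
  apply: sum_eq_le_collision => // i y; apply: le_trans (Xa i).
  by apply: ereal_sup_ubound; exists y.
by rewrite lee_fin; apply: collision_le_excess.
Qed.
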